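(* For every graph $F$ containing a cycle and all integers $r\geq 2$ and $n\in\mathbb{N}$ there exists a graph $G$ with $G\longrightarrow(F)_r$ such that every subgraph $H\subseteq G$ on $n$ vertices satisfies $H\not\xrightarrow{\text{n.n.i.}}(F)_2$.
   Context: $G\longrightarrow(F)_r$ means that every colouring of $E(G)$ with $r$ colours yields a monochromatic copy of $F$ which is an induced subgraph of $G$. $H\xrightarrow{\text{n.n.i.}}(F)_2$ means that every colouring of $E(H)$ with 2 colours yields a monochromatic (not necessarily induced) subgraph isomorphic to $F$; $H\not\xrightarrow{\text{n.n.i.}}(F)_2$ is its negation, i.e., there is a 2-colouring of $E(H)$ with no monochromatic subgraph isomorphic to $F$. *)

(* Defs.v *)
From mathcomp Require Import all_boot.

Set Implicit Arguments.
Unset Strict Implicit.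
Unset Printing Implicit Defensive.

Record sgraph : Type := SGraph {
  vertex :> finType;
  adj : rel vertex;
  adj_sym : symmetric adj;
  adj_irr : irreflexive adj }.

Definition edges (G : sgraph) : {set {set G}} :=
  [set [set p.1; p.2] | p : G * G & adj p.1 p.2].

Lemma in_edges (G : sgraph) (x y : G) :
  ([set x; y] \in edges G) = adj x y.
Proof.
apply/imsetP/idP => [[[u v] /=]|xy]; last by exists (x, y); rewrite ?inE.
rewrite inE /= => uv exy.
have nuv : u != v by apply: contraTneq uv => ->; rewrite adj_irr.
have xin : x \in [set u; v] by rewrite -exy set21.
have yin : y \in [set u; v] by rewrite -exy set22.
have nxy : x != y.
  apply: contra_eqN exy => /eqP ->.
  by apply/eqP => /(congr1 (fun A : {set G} => #|A|)); rewrite !cards2 eqxx nuv.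
move: xin yin nxy; rewrite !inE.
by case/orP=> /eqP-> /orP[]/eqP->; rewrite ?eqxx // adj_sym.
Qed.

Record subgraph (G : sgraph) : Type := Subgraph {
  sub_vset : {set G};
  sub_eset : {set {set G}};
  sub_edges : sub_eset \subset edges G;
  sub_ends : forall e, e \in sub_eset -> e \subset sub_vset }.

Section SubgraphAsGraph.
Variables (G : sgraph) (S : subgraph G).

Definition sub_vertex : finType := {x : G | x \in sub_vset S}.

Definition sub_adj : rel sub_vertex :=
  fun x y => [set val x; val y] \in sub_eset S.

Lemma sub_adj_sym : symmetric sub_adj.
Proof. by move=> x y; rewrite /sub_adj setUC. Qed.

Lemma sub_adj_irr : irreflexive sub_adj.
Proof.
move=> x; apply/negP => /(subsetP (sub_edges S)).
by rewrite in_edges adj_irr.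
Qed.

Definition sgraph_of_subgraph : sgraph := SGraph sub_adj_sym sub_adj_irr.

End SubgraphAsGraph.

Coercion sgraph_of_subgraph : subgraph >-> sgraph.

Definition induced (G : sgraph) (S : subgraph G) : Prop :=
  forall e, e \in edges G -> e \subset sub_vset S -> e \in sub_eset S.

Definition isomorphic (F G : sgraph) : Prop :=
  exists f : F -> G, bijective f /\ {mono f : x y / adj x y}.

Definition contains_cycle (F : sgraph) : Prop :=
  exists c : seq F, 2 < size c /\ ucycle (@adj F) c.

Definition edge_colouring (G : sgraph) (r : nat) : Type :=
  {e : {set G} | e \in edges G} -> 'I_r.

Definition monochromatic (G : sgraph) (r : nat) (c : edge_colouring G r)
    (S : subgraph G) : Prop :=
  exists k : 'I_r, forall e, val e \in sub_eset S -> c e = k.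

(* G --> (F)_r *)
Definition induced_arrows (G F : sgraph) (r : nat) : Prop :=
  forall c : edge_colouring G r, exists S : subgraph G,
    [/\ induced S, isomorphic F S & monochromatic c S].

(* G --n.n.i.--> (F)_r *)
Definition nni_arrows (G F : sgraph) (r : nat) : Prop :=
  forall c : edge_colouring G r, exists S : subgraph G,
    isomorphic F S /\ monochromatic c S.

(* Main.v *)
Require Import Defs.
From mathcomp Require Import all_boot.
From mathcomp Require Import zify.

(* Let K be a set of edges of F maximising m = (|K| - 1) / (|V(K)| - 2), of minimal
   size; write m = a / b. Call a nonempty edge set X sparse if
   b (|X| - 1) <= a (|V(X)| - 2), and tight in case of equality. By submodularity of
   the defect, in a graph all of whose edge sets are sparse a copy of K meets a tight
   edge set in nothing, in one edge, or is contained in it. Hence the copies of K are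
   arranged like a hyperforest on the edges, and since |K| >= 3 (F has a cycle) the
   edges can be 2-coloured without a monochromatic copy of K, let alone of F.

   It remains to find an induced Ramsey graph for F whose edge sets spanning at most n
   vertices are all sparse. Take any induced Ramsey graph R (partite construction), its
   blow-up with N vertices per class, and keep each edge with probability slightly
   larger than N^(-1/m). Copies of F projecting to induced copies in R are induced.
   A container theorem shows that each colour class without such a copy lies in one of
   few sets with few copies, so that, R being Ramsey, r such sets miss a positive
   proportion of the blow-up; by a union bound the random graph meets every such
   complement in many edges. There are few non-sparse small edge sets, and deleting
   an edge from each of them does not destroy this property. *)

Set Implicit Arguments.
Unset Strict Implicit.
Unset Printing Implicit Defensive.

(** * Sparse and tight edge sets *)

Section TightSets.
Variables (V : finType) (a b : nat).
Implicit Types (X Y J E S : {set {set V}}).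

(** Moving [2 * a] to the left avoids a truncated subtraction; a single two-element edge is
    tight. *)
Definition sparse X := b * (#|X|.-1) + 2 * a <= a * #|cover X|.
Definition tight X := b * (#|X|.-1) + 2 * a == a * #|cover X|.

Definition hereditarily_sparse E := forall X, X \subset E -> X != set0 -> sparse X.

Definition tight_atom S := [/\ tight S, 2 < #|S| &
  forall X, X \subset S -> X != set0 -> tight X -> X = S \/ #|X| = 1].

Lemma coverU X Y : cover (X :|: Y) = cover X :|: cover Y.
Proof. exact: bigcup_setU. Qed.

Lemma coverS X Y : X \subset Y -> cover X \subset cover Y.
Proof.
move=> XY; apply/bigcupsP => e eX; apply: bigcup_sup; exact: (subsetP XY).
Qed.

(** Uncrossing: edge counts are modular and covers submodular, so sparsity of [X :|: Y] and of
    [X :&: Y] leaves no slack in either. *)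
Lemma tight_UI E X Y : hereditarily_sparse E -> X \subset E -> Y \subset E ->
  X :&: Y != set0 -> tight X -> tight Y -> tight (X :|: Y) /\ tight (X :&: Y).
Proof.
move=> sp XE YE XY0 tX tY.
have XYE : X :|: Y \subset E by rewrite subUset XE.
have IE : X :&: Y \subset E := subset_trans (subsetIl X Y) XE.
have U0 : X :|: Y != set0.
  by apply: contraNneq XY0 => U0; rewrite -subset0 -U0 (subset_trans (subsetIl _ _)) ?subsetUl.
have := sp _ XYE U0; have := sp _ IE XY0.
move: tX tY; rewrite /sparse /tight => /eqP tX /eqP tY.
have := cardsUI X Y; have := cardsUI (cover X) (cover Y).
have : #|cover (X :&: Y)| <= #|cover X :&: cover Y|.
  by apply: subset_leq_card; rewrite subsetI !coverS ?subsetIl ?subsetIr.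
have I1 : 0 < #|X :&: Y| by rewrite card_gt0.
have cX := subset_leq_card (subsetIl X Y); have cY := subset_leq_card (subsetIr X Y).
have cU := subset_leq_card (subsetUl X Y).
rewrite coverU.
move: tX tY I1 cX cY cU.
move: #|X| #|Y| #|X :&: Y| #|X :|: Y| #|cover X| #|cover Y| #|cover (X :&: Y)|
  #|cover X :&: cover Y| #|cover X :|: cover Y| => x y i u cx cy ci ii uu.
move=> tX tY I1 cX cY cU le e1 e2 s1 s2.
have E2 : b * u.-1 + b * i.-1 = b * x.-1 + b * y.-1 by rewrite -!mulnDr; congr (_ * _); lia.
have E1 : a * uu + a * ii = a * cx + a * cy by rewrite -!mulnDr e1.
have E3 : a * ci <= a * ii by rewrite leq_mul2l le orbT.
by split; apply/eqP; lia.
Qed.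

Section Colouring.
Variable Q : pred {set {set V}}.
Hypothesis atoms : forall S, Q S -> tight_atom S.

Definition proper_on (col : {set V} -> bool) E := forall S, Q S -> S \subset E ->
  forall k, exists2 e, e \in S & col e = k.

(** [S :&: J] is tight by uncrossing, and minimality of the atom [S] applies to it. *)
Lemma tight_atom_meet E S J : hereditarily_sparse E -> S \subset E -> J \subset E ->
  tight J -> tight_atom S -> S :&: J != set0 -> S \subset J \/ #|S :&: J| = 1.
Proof.
move=> sp SE JE tJ [tS S2 minS] SJ0.
have [_ tI] := tight_UI sp SE JE SJ0 tS tJ.
by case: (minS _ (subsetIl _ _) SJ0 tI) => [/setIidPl|]; [left|right].
Qed.

(* A copy meeting a tight set [J] without being contained in it meets [J] in one
   edge only, so its other edges, at least two, are free to receive both colours. *)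
Lemma extend_colouring E S J col : hereditarily_sparse E -> S \subset E -> J \subset E ->
  tight J -> proper_on col J -> Q S -> #|S :&: J| = 1 ->
  exists col', proper_on col' (J :|: S).
Proof.
move=> sp SE JE tJ pJ QS SJ1.
have [tS S2 minS] := atoms QS.
have : 1 < #|S :\: J| by have := cardsID J S; rewrite SJ1; lia.
case/card_gt1P => e1 [e2 [e1S e2S e12]].
exists (fun e => if e == e1 then true else if e == e2 then false else col e).
move=> S' QS' S'U k.
have [SS|nSS] := eqVneq S' S.
  subst S'; move: e1S e2S; rewrite !inE => /andP[_ e1S] /andP[_ e2S].
  case: k; [exists e1 | exists e2]; rewrite ?eqxx //.
  by rewrite eq_sym (negbTE e12).
have [S'J|nS'J] := boolP (S' \subset J).
  have [e eS ce] := pJ S' QS' S'J k; exists e => //.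
  have eJ := subsetP S'J _ eS; move: e1S e2S; rewrite !inE => /andP[n1 _] /andP[n2 _].
  by rewrite !ifN //; apply: contraTneq eJ => ->.
have [tS' S'2 minS'] := atoms QS'.
have US : J :|: S \subset E by rewrite subUset JE.
have S'E := subset_trans S'U US.
(* Another copy [S'] not inside [J] shares at most one edge with [J] and at most one with [S]; it
   would have at most two edges, too few for an atom. *)
have c1 : #|S' :&: J| <= 1.
  have [->|n0] := eqVneq (S' :&: J) set0; first by rewrite cards0.
  case: (tight_atom_meet sp S'E JE tJ (atoms QS') n0) => [|->//].
  by rewrite (negbTE nS'J).
have c2 : #|S' :&: S| <= 1.
  have [->|n0] := eqVneq (S' :&: S) set0; first by rewrite cards0.
  have [_ tI] := tight_UI sp S'E SE n0 tS' tS.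
  case: (minS _ (subsetIr _ _) n0 tI) => [E1|->//].
  case: (minS' _ (subsetIl _ _) n0 tI) => [E2|->//].
  by rewrite -E1 {1}E2 eqxx in nSS.
have : #|S'| <= #|S' :&: J| + #|S' :&: S|.
  by rewrite -{1}(setIidPl S'U) setIUr; apply: leq_card_setU.
by move/leq_trans/(_ (leq_add c1 c2)); rewrite leqNgt S'2.
Qed.

(** Starting from one copy, copies meeting the current set are absorbed one by one: uncrossing keeps
    it tight, [extend_colouring] keeps it coloured, and finiteness of [E] ends the process. *)
Lemma closed_tight_set E S0 : hereditarily_sparse E -> Q S0 -> S0 \subset E ->
  exists J, [/\ J \subset E, J != set0, exists col, proper_on col J &
    forall S, Q S -> S \subset E -> S :&: J != set0 -> S \subset J].
Proof.
move=> sp QS0 S0E; have [tS0 S02 minS0] := atoms QS0.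
have S00 : S0 != set0 by rewrite -card_gt0 (ltnW (ltnW S02)).
have : exists col, proper_on col S0.
  case/card_gt1P: (ltnW S02) => e1 [e2 [e1S e2S e12]].
  exists (fun e => e == e1) => S QS SS0 k; have [tS S2 _] := atoms QS.
  have [|->|S1] := minS0 S SS0 _ tS; first by rewrite -card_gt0 (ltnW (ltnW S2)).
    by case: k; [exists e1; rewrite ?eqxx | exists e2; rewrite // eq_sym (negbTE e12)].
  by rewrite S1 in S2.
move: {minS0 S02 QS0} S0 S0E tS0 S00 => J.
have [n] := ubnP (#|E| - #|J|); elim: n J => // n IH J; rewrite ltnS => Jn JE tJ J0 [col pJ].
case: (boolP [exists S : {set {set V}},
    [&& Q S, S \subset E, S :&: J != set0 & ~~ (S \subset J)]]).
  case/existsP => S /and4P[QS SE SJ nSJ].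
  have SJ1 : #|S :&: J| = 1.
    by case: (tight_atom_meet sp SE JE tJ (atoms QS) SJ) => // SJ'; rewrite SJ' in nSJ.
  have [tS _ _] := atoms QS.
  have [|tU _] := tight_UI sp JE SE _ tJ tS; first by rewrite setIC.
  have UE : J :|: S \subset E by rewrite subUset JE.
  have ltJ : #|J| < #|J :|: S|.
    apply/proper_card/properP; split; first exact: subsetUl.
    by case/subsetPn: nSJ => x xS xJ; exists x; rewrite // inE xS orbT.
  apply: (IH (J :|: S)) => //.
  - apply: leq_trans Jn; apply: ltn_sub2l => //.
    exact: leq_trans ltJ (subset_leq_card UE).
  - by apply: contraNneq J0 => U0; rewrite -subset0 -U0 subsetUl.
  exact: (extend_colouring sp SE JE tJ pJ QS SJ1).
move/existsPn => closed; exists J; split=> //; first by exists col.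
move=> S QS SE SJ; have := closed S; rewrite QS SE SJ /= negbK; exact.
Qed.

(** Closed tight sets are peeled off: a copy lies inside [J] or inside [E :\: J], so the two parts
    can be coloured independently. *)
Lemma two_colouring E : hereditarily_sparse E -> exists col, proper_on col E.
Proof.
have [n] := ubnP #|E|; elim: n E => // n IH E; rewrite ltnS => En sp.
case: (pickP (fun S => Q S && (S \subset E))) => [S0 /andP[QS0 S0E]|none]; last first.
  by exists xpredT => S QS SE; have := none S; rewrite QS SE.
have [J [JE J0 [colJ pJ] closed]] := closed_tight_set sp QS0 S0E.
have [||col pE] := IH (E :\: J).
- apply: leq_trans En; have := cardsID J E; rewrite (setIidPr JE).
  by move: J0; rewrite -card_gt0; lia.
- by move=> X XE; apply: sp; apply: subset_trans XE (subsetDl _ _).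
exists (fun e => if e \in J then colJ e else col e) => S QS SE k.
have [SJ0|SJ0] := eqVneq (S :&: J) set0.
  have SEJ : S \subset E :\: J by rewrite subsetD SE -setI_eq0 SJ0 eqxx.
  have [e eS ce] := pE S QS SEJ k; exists e => //.
  by have := subsetP SEJ _ eS; rewrite inE => /andP[/negbTE->].
have SJ := closed S QS SE SJ0; have [e eS ce] := pJ S QS SJ k; exists e => //.
by rewrite (subsetP SJ).
Qed.

End Colouring.
End TightSets.

(** * Cycles and densest edge sets *)

Lemma next_next_neq (T : eqType) (c : seq T) x : uniq c -> 2 < size c -> x \in c ->
  next c (next c x) != x.
Proof.
move=> uc sc /rot_to[i s E]; have uc' : uniq (rot i c) by rewrite rot_uniq.
have sc' : 2 < size (rot i c) by rewrite size_rot.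
rewrite -!(next_rot i uc); move: uc' sc'; rewrite E.
case: s {E} => [|y [|z s]] //= /and3P[]; rewrite !inE !negb_or => /and3P[xy xz _] /andP[yz _] _ _.
by rewrite !eqxx [y == x]eq_sym (negbTE xy) eq_sym.
Qed.

Lemma edgesP (G : sgraph) (e : {set G}) :
  reflect (exists x y, adj x y /\ e = [set x; y]) (e \in edges G).
Proof.
apply: (iffP imsetP) => [[[x y]]|[x [y [xy ->]]]]; last by exists (x, y); rewrite ?inE.
by rewrite inE /= => xy ->; exists x, y.
Qed.

Lemma card_edge (G : sgraph) (e : {set G}) : e \in edges G -> #|e| = 2.
Proof.
case/edgesP => x [y [xy ->]]; rewrite cards2.
by case: eqP xy => // ->; rewrite adj_irr.
Qed.

(** The edges of a cycle witness that the maximal density exceeds 1, which becomes [b < a] below. *)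
Lemma cycle_edges (F : sgraph) : contains_cycle F ->
  exists2 Z : {set {set F}}, Z \subset edges F & 2 < #|Z| /\ #|cover Z| <= #|Z|.
Proof.
case=> c [sc /andP[cyc uc]]; pose ed x := [set x; next c x].
have cZ : #|[set ed x | x in c]| = size c.
  rewrite card_in_imset; first by apply/card_uniqP.
  move=> x y xc yc E; apply: contraTeq (next_next_neq uc sc xc) => nxy.
  have : x \in ed y by rewrite -E set21.
  have : y \in ed x by rewrite E set21.
  rewrite !inE eq_sym (negbTE nxy) /= => /eqP -> /eqP <-.
  by rewrite eqxx.
exists [set ed x | x in c].
  apply/subsetP => e /imsetP[x xc ->]; apply/edgesP; exists x, (next c x); split=> //.
  exact: next_cycle.
split; first by rewrite cZ.
rewrite cZ -(card_uniqP uc); apply: subset_leq_card.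
apply/subsetP => y /bigcupP[e /imsetP[x xc ->]].
by rewrite !inE => /orP[]/eqP->; rewrite ?mem_next.
Qed.

Lemma cover_edges_gt2 (F : sgraph) (X : {set {set F}}) : X \subset edges F -> 1 < #|X| ->
  2 < #|cover X|.
Proof.
move=> XF /card_gt1P[e [e' [eX eX' ne]]].
have sub d : d \in X -> d \subset cover X by move=> dX; apply: bigcup_sup.
rewrite ltnNge; apply/negP => le.
have eq d : d \in X -> d = cover X.
  move=> dX; apply/eqP; rewrite eqEcard sub //= (card_edge (subsetP XF _ dX)) //.
by rewrite (eq e) // -(eq e') // eqxx in ne.
Qed.

(** With [a = #|K|.-1] and [b = #|cover K| - 2] for a densest [K], maximality gives sparsity of all
    edge sets, and minimal size makes [K] an atom. *)
Lemma densest_core (F : sgraph) : contains_cycle F ->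
  exists a b (K : {set {set F}}), [/\ 0 < b, b < a, K \subset edges F,
    hereditarily_sparse a b (edges F) & tight_atom a b K].
Proof.
case/cycle_edges => Z ZF [Z2 Zle].
pose cand (X : {set {set F}}) := (X \subset edges F) && (1 < #|X|).
have candZ : cand Z by rewrite /cand ZF ltnW.
pose n := #|F|; pose B := #|edges F|.+1.
(* clearing denominators in [(#|X| - 1) / (#|cover X| - 2)] *)
pose key (X : {set {set F}}) := (#|X|.-1) * (n`! %/ (#|cover X| - 2)).
(* The objective is lexicographic: [B] exceeds every [#|X|], so density is maximised first and size
   minimised second. *)
case: (@arg_maxnP _ Z cand (fun X => key X * B + (B - #|X|)) candZ) => K /andP[KF K1] maxK.
have cov (X : {set {set F}}) : cand X -> 
    exists y, [/\ 0 < y, #|cover X| = y + 2 & n`! %/ y * y = n`!].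
  case/andP => XF X1; have c2 := cover_edges_gt2 XF X1.
  exists (#|cover X| - 2); split; [lia|lia|]; apply: divnK; apply: dvdn_fact.
  have : #|cover X| <= n by rewrite /n max_card.
  lia.
have cardB (X : {set {set F}}) : cand X -> #|X| < B.
  by case/andP => XF _; rewrite ltnS subset_leq_card.
have max1 (X : {set {set F}}) : cand X -> key X <= key K.
  move=> cX; have := maxK X cX; have := cardB X cX.
  have := cardB K; rewrite /cand KF K1 => /(_ isT); rewrite leqNgt => h1 h2 h3.
  apply/negP => lt; move: h3; nia.
have max2 (X : {set {set F}}) : cand X -> key X = key K -> #|K| <= #|X|.
  move=> cX e; have := maxK X cX => /=; rewrite /geq /= e leq_add2l; have := cardB X cX.
  have := cardB K; rewrite /cand KF K1 => /(_ isT)/ltnW le _; rewrite leq_sub2lE //.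
have [|b [b_gt0 cK bn]] := cov K; first by rewrite /cand KF K1.
have a_gt0 : 0 < #|K|.-1 by lia.
have n_gt0 : 0 < n`! by rewrite fact_gt0.
have keyE (X : {set {set F}}) : cand X -> exists2 y, #|cover X| = y + 2 &
    key X * (y * b) = #|X|.-1 * b * n`! /\ key K * (y * b) = #|K|.-1 * y * n`!.
  move=> cX; have [y [y_gt0 cXy yn]] := cov X cX; exists y => //.
  rewrite /key cXy cK !addnK; split.
    by rewrite -[in RHS]yn; move: (n`! %/ y) #|X|.-1 => q p; clear; lia.
  by rewrite -[in RHS]bn; move: (n`! %/ b) #|K|.-1 => q p; clear; lia.
have sp : hereditarily_sparse #|K|.-1 b (edges F).
  move=> X XF X0; rewrite /sparse; move: X0; rewrite -card_gt0.
  rewrite leq_eqVlt => /orP[/eqP X1|X1].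
    rewrite -X1 muln0 mulnC leq_mul2l; apply/orP; right.
    move/esym/eqP/cards1P: X1 => [e E]; rewrite E /cover big_set1 card_edge //.
    by apply: (subsetP XF); rewrite E inE.
  have cX : cand X by rewrite /cand XF.
  have [y cXy [k1 k2]] := keyE X cX; rewrite cXy mulnDr [#|K|.-1 * 2]mulnC leq_add2r.
  by rewrite [b * _]mulnC -(leq_pmul2r n_gt0) -k1 -k2 leq_mul2r max1 // orbT.
have Z0 : Z != set0 by rewrite -card_gt0; lia.
(* If [a <= b], sparsity of [Z] together with [#|cover Z| <= #|Z|] would force [a = 0]. *)
have ltba : b < #|K|.-1.
  have := sp Z ZF Z0; rewrite /sparse; move: #|K|.-1 a_gt0 => a a_gt0 h.
  have : a * #|cover Z| <= a * #|Z| by rewrite leq_mul2l Zle orbT.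
  move: h Z2; case: #|Z| => [|[|z]] //= h z0 h'.
  rewrite ltnNge; apply/negP => ab.
  have : a * z.+1 <= b * z.+1 by rewrite leq_mul2r ab orbT.
  lia.
exists #|K|.-1, b, K; split=> //; split; first by rewrite /tight cK -mulnDl mulnC.
  by lia.
move=> X XK X0; rewrite /tight => /eqP tX.
have [X1|nX1] := eqVneq #|X| 1; [by right|left].
have cX : cand X.
  rewrite /cand (subset_trans XK KF) /=; move: X0; rewrite -card_gt0.
  by rewrite leq_eqVlt eq_sym (negbTE nX1).
have [y cXy [k1 k2]] := keyE X cX.
have [y' [y_gt0 cXy' _]] := cov X cX.
apply/eqP; rewrite eqEcard XK max2 //; apply/eqP.
have pos : 0 < y * b by rewrite muln_gt0 b_gt0 andbT; lia.
rewrite -(eqn_pmul2r pos) k1 k2 eqn_pmul2r //; apply/eqP.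
by move: tX; rewrite cXy mulnDr [_ * 2]mulnC => /addIn; rewrite mulnC.
Qed.

(** * The induced Ramsey theorem *)

Section HalesJewett.
Variable A : finType.

(** A combinatorial line as a template: [None] marks the moving coordinates. *)
Definition cline (I : finType) := {ffun I -> option A}.
Definition line_pt (I : finType) (l : cline I) (a : A) : {ffun I -> A} :=
  [ffun i => odflt a (l i)].
Definition active (I : finType) (l : cline I) := [exists i, l i == None].
Definition join (B : Type) (I J : finType) (u : {ffun I -> B}) (v : {ffun J -> B}) :
  {ffun I + J -> B} := [ffun x => match x with inl i => u i | inr j => v j end].
Definition const_line (I : finType) (u : {ffun I -> A}) : cline I := [ffun i => Some (u i)].

Lemma line_pt_join (I J : finType) (l : cline I) (m : cline J) a :
  line_pt (join l m) a = join (line_pt l a) (line_pt m a).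
Proof. by apply/ffunP => -[] x; rewrite !ffunE. Qed.

Lemma line_pt_const (I : finType) (u : {ffun I -> A}) a : line_pt (const_line u) a = u.
Proof. by apply/ffunP => x; rewrite !ffunE. Qed.

Lemma active_joinl (I J : finType) (l : cline I) (m : cline J) :
  active l -> active (join l m).
Proof. by case/existsP => i li; apply/existsP; exists (inl i); rewrite ffunE. Qed.

Lemma active_joinr (I J : finType) (l : cline I) (m : cline J) :
  active m -> active (join l m).
Proof. by case/existsP => i li; apply/existsP; exists (inr i); rewrite ffunE. Qed.

(** Words use all of [A], but agreement of colours concerns only the letters in [s]; this permits
    induction on the alphabet. *)
Definition mono_line (I : finType) (kT : Type) (c : {ffun I -> A} -> kT) (s : seq A) l :=
  active l /\ {in s &, forall a b, c (line_pt l a) = c (line_pt l b)}.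

Definition HJ_alphabet (s : seq A) := forall kT : finType, exists I : finType,
  forall c : {ffun I -> A} -> kT, exists l, mono_line c s l.

(* Colour focusing: [q.1] ranges over lines through a common point at letter [a0]
   which are constantly coloured on [s] in pairwise different colours [q.2]. *)
Lemma HJ_focus (s : seq A) a0 (kT : finType) : HJ_alphabet s -> forall n,
  exists I : finType, forall c : {ffun I -> A} -> kT,
    (exists l, mono_line c (a0 :: s) l) \/
    exists f (L : seq (cline I * kT)),
      [/\ size L = n, uniq (map snd L) &
          forall q, q \in L -> [/\ active q.1, line_pt q.1 a0 = f &
             {in s, forall a, c (line_pt q.1 a) = q.2}]].
Proof.
move=> HJs; elim=> [|n [I HI]].
  (* Indexing by [A] itself provides a word, the identity, even if [A] is empty. *)
  by exists A => c; right; exists [ffun x => x], [::].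
have [I' HI'] := HJs {ffun {ffun I -> A} -> kT}.
exists (I' + I)%type => c.
(* The first block is coloured by the whole colouring it induces on the second; along [l'] this is
   the same colouring [C] for all letters of [s]. *)
have [l' [act' mono']] := HI' (fun u => [ffun v => c (join u v)]).
pose u1 := line_pt l' (head a0 s); pose C v := c (join u1 v).
have CE a v : a \in s -> c (join (line_pt l' a) v) = C v.
  move=> as_; have hs : head a0 s \in s by case: (s) as_ => //= x s' _; rewrite mem_head.
  by have /ffunP/(_ v) := mono' _ _ as_ hs; rewrite !ffunE.
have up l : mono_line C (a0 :: s) l -> exists l, mono_line c (a0 :: s) l.
  case=> actl mono; exists (join (const_line u1) l); split; first exact: active_joinr.
  by move=> a b ain bin; rewrite !line_pt_join !line_pt_const; apply: mono.
case: (HI C) => [[l /up]|[f [L [sL uL HL]]]]; first by left.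
(* If [C f] is already a colour of some line, that line is also monochromatic at [a0]; otherwise
   [l'] joined with the constant block [f] is a line of a new colour. *)
case: (boolP (C f \in map snd L)) => [/mapP[q qL Cf]|nL].
  left; have [act focus mono] := HL _ qL; apply: (up q.1); split=> // a b.
  have E x : x \in a0 :: s -> C (line_pt q.1 x) = q.2.
    by rewrite inE => /orP[/eqP->|/mono//]; rewrite focus.
  by move=> /E-> /E->.
right; exists (join (line_pt l' a0) f).
exists ((join l' (const_line f), C f) :: [seq (join l' q.1, q.2) | q <- L]).
split=> /=; first by rewrite size_map sL.
  rewrite -map_comp (eq_map (g := snd)) ?uL ?andbT //.
move=> q; rewrite inE => /orP[/eqP->|/mapP[q' qL ->]] /=.
  split; [exact: active_joinl | by rewrite line_pt_join line_pt_const |].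
  by move=> a ain; rewrite line_pt_join line_pt_const CE.
have [act focus mono] := HL _ qL.
split; [exact: active_joinl | by rewrite line_pt_join focus |].
by move=> a ain; rewrite line_pt_join CE // mono.
Qed.

(** Induction on the alphabet: [#|kT|.+1] focused lines cannot have pairwise different colours, so
    [HJ_focus] must produce a monochromatic line. *)
Theorem Hales_Jewett (kT : finType) : exists I : finType,
  forall c : {ffun I -> A} -> kT, exists l, mono_line c (enum A) l.
Proof.
suff: forall s, HJ_alphabet s by apply.
elim=> [|a0 s IHs] {}kT.
  exists unit => c; exists [ffun=> None]; split=> //.
  by apply/existsP; exists tt; rewrite ffunE.
have [I HI] := HJ_focus a0 kT IHs #|kT|.+1; exists I => c.
case: (HI c) => // -[f [L [sL uL _]]].
have := max_card (mem (map snd L)); rewrite (card_uniqP uL) size_map sL ltnn //.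
Qed.

End HalesJewett.

(** * Ramsey's theorem for pairs *)

Section RamseyPairs.
Variables (T : finType) (r : nat) (c : {set T} -> 'I_r).

Definition mono_clique k (C : {set T}) :=
  {in C &, forall x y, x != y -> c [set x; y] = k}.

End RamseyPairs.

(** Induction on the sum of the clique sizes: a large neighbourhood of [x] in colour [k] contains a
    clique, which [x] enlarges if the clique has colour [k]. *)
Lemma Ramsey_pairs_set r (t : 'I_r -> nat) : exists L, forall (T : finType)
  (c : {set T} -> 'I_r) (S : {set T}), L <= #|S| ->
  exists k (C : {set T}), [/\ C \subset S, #|C| = t k & mono_clique c k C].
Proof.
have [n] := ubnP (\sum_k t k); elim: n t => // n IH t tn.
case: (boolP [exists k, t k == 0]) => [/existsP[k /eqP tk]|].
  exists 0 => T c S _; exists k, set0; rewrite sub0set cards0; split=> // x y.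
  by rewrite inE.
move/existsPn => t_gt0.
pose t' (k i : 'I_r) := if i == k then (t i).-1 else t i.
have rec k : exists L, forall (T : finType)
  (c : {set T} -> 'I_r) (S : {set T}), L <= #|S| ->
  exists i (C : {set T}), [/\ C \subset S, #|C| = t' k i & mono_clique c i C].
  apply: IH; rewrite -ltnS; apply: leq_trans tn; rewrite ltnS.
  rewrite (bigD1 k) //= [X in _ < X](bigD1 k) //=.
  rewrite /t' eqxx -addSn prednK ?lt0n // leq_add2l.
  by apply: leq_sum => i; case: (i == k).
have [L HL] : exists L : 'I_r -> nat, forall k (T : finType)
  (c : {set T} -> 'I_r) (S : {set T}), L k <= #|S| ->
  exists i (C : {set T}), [/\ C \subset S, #|C| = t' k i & mono_clique c i C].
  have := @fin_all_exists 'I_r (fun _ => nat) _ rec; exact.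
(* Pigeonhole on the colours at [x]: one unit of [.+2] is spent on [x], the other makes the
   inequality strict. *)
exists (\sum_k L k).+2 => T c S LS.
have /card_gt0P[x xS] : 0 < #|S| by apply: leq_trans LS.
pose N k := [set y in S :\ x | c [set x; y] == k].
have [k Nk] : exists k, L k <= #|N k|.
  apply/existsP; apply: contraTT LS => /existsPn small; rewrite -leqNgt.
  rewrite (cardsD1 x) xS add1n ltnS.
  have -> : #|S :\ x| = \sum_k #|N k|.
    rewrite -sum1_card (partition_big (fun y => c [set x; y]) xpredT) //=.
    by apply: eq_bigr => k _; rewrite -sum1_card; apply: eq_bigl => y; rewrite !inE.
  by apply: leq_sum => k _; have := small k; rewrite -ltnNge => /ltnW.
have [i [C [CN cC mC]]] := HL k T c (N k) Nk.
have NS : N k \subset S by apply/subsetP => y; rewrite !inE => /andP[/andP[]].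
have CS := subset_trans CN NS.
move: cC; rewrite /t'; case: eqP => [ik cC|_ cC]; last by exists i, C.
exists k, (x |: C); split.
- by rewrite subUset sub1set xS.
- have xC : x \notin C by apply/negP => /(subsetP CN); rewrite !inE eqxx.
  by rewrite cardsU1 xC cC ik add1n prednK // lt0n.
have xy y : y \in C -> c [set x; y] = k.
  by move/(subsetP CN); rewrite !inE => /andP[_ /eqP].
move=> y z; rewrite !inE => /orP[/eqP->|yC] /orP[/eqP->|zC] yz; rewrite ?eqxx // in yz *.
- exact: xy.
- by rewrite setUC; apply: xy.
by rewrite -ik; apply: mC.
Qed.

Lemma Ramsey_pairs (F : finType) r : exists L, forall c : {set 'I_L} -> 'I_r,
  exists k (g : F -> 'I_L), injective g /\
    forall x y, x != y -> c [set g x; g y] = k.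
Proof.
have [L HL] := @Ramsey_pairs_set r (fun _ => #|F|).
exists L => c; have [|k [C [_ cC mC]]] := HL _ c setT; first by rewrite cardsT card_ord.
exists k, (fun x => enum_val (cast_ord (esym cC) (enum_rank x))); split.
  by move=> x y /enum_val_inj/cast_ord_inj/enum_rank_inj.
move=> x y xy; apply: mC; rewrite ?enum_valP //.
by apply: contraNneq xy => /enum_val_inj/cast_ord_inj/enum_rank_inj->.
Qed.

(** * The partite construction *)

Definition embedding (F G : sgraph) (f : F -> G) :=
  injective f /\ {mono f : x y / adj x y}.

Section PartitePower.
Variables (P : sgraph) (J : finType) (part : P -> J) (i j : J) (I : finType).
Hypothesis ij : i != j.
Hypothesis part_adj : forall x y : P, adj x y -> part x != part y.

(** These oriented edges between the parts [i] and [j] are the letters for Hales-Jewett. *)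
Definition crossing : finType :=
  {e : P * P | [&& adj e.1 e.2, part e.1 == i & part e.2 == j]}.

(* [inl (true, u)] and [inl (false, u)] are the vertices over the parts [i] and [j];
   the other parts are disjoint copies of those of [P], one for each line [l]. *)
Definition power_vertex : finType :=
  ((bool * {ffun I -> P}) + (P * cline crossing I))%type.

Definition power_part (p : power_vertex) : J :=
  match p with inl (b, _) => if b then i else j | inr (x, _) => part x end.

(** A moving coordinate carries [x] itself, a fixed one the end of its edge in the part of [x]. *)
Definition line_emb (l : cline crossing I) (x : P) : power_vertex :=
  if part x == i then inl (true, [ffun t => oapp (fun a => (val a).1) x (l t)])
  else if part x == j then inl (false, [ffun t => oapp (fun a => (val a).2) x (l t)])
  else inr (x, l).

Definition outer x := (part x != i) && (part x != j).

(** Edges with an end outside the parts [i] and [j] are copied along lines; those between the two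
    parts come coordinatewise from [new_adj]. *)
Definition old_adj (p q : power_vertex) := [exists l : cline crossing I, exists x, exists y,
  [&& p == line_emb l x, q == line_emb l y, adj x y & outer x || outer y]].

Definition new_adj (p q : power_vertex) := match p, q with
  | inl (true, u), inl (false, w) =>
    [forall t, [&& adj (u t) (w t), part (u t) == i & part (w t) == j]]
  | _, _ => false end.

Definition power_adj p q := [|| old_adj p q, new_adj p q | new_adj q p].

Lemma power_part_line l x : power_part (line_emb l x) = part x.
Proof. by rewrite /line_emb; case: eqP => [//|_]; case: eqP. Qed.

Lemma power_adj_sym : symmetric power_adj.
Proof.
move=> p q; rewrite /power_adj [new_adj q p || _]orbC; congr (_ || _).
by apply/existsP/existsP => -[l /existsP[x /existsP[y /and4P[px qy xy o]]]];
  exists l; apply/existsP; exists y; apply/existsP; exists x;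
  rewrite px qy adj_sym xy orbC.
Qed.

Lemma power_adj_part p q : power_adj p q -> power_part p != power_part q.
Proof.
have new p' q' : new_adj p' q' -> power_part p' = i /\ power_part q' = j.
  by case: p' q' => [[[] u]|[x l]] [[[] v]|[y m]].
case/or3P => [|/new[-> ->]//|/new[-> ->]].
  case/existsP => l /existsP[x /existsP[y /and4P[/eqP-> /eqP-> xy _]]].
  by rewrite !power_part_line part_adj.
by rewrite eq_sym.
Qed.

Lemma power_adj_irr : irreflexive power_adj.
Proof. by move=> p; apply/negP => /power_adj_part; rewrite eqxx. Qed.

Definition power_graph := SGraph power_adj_sym power_adj_irr.

(** An active coordinate recovers [x] and adjacency between the two parts; outer vertices remember
    [l], so an old edge inside the copy comes from the copy itself. *)
Lemma line_emb_embedding l : active l ->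
  embedding (line_emb l : P -> power_graph).
Proof.
case/existsP => t /eqP lt.
have inj : injective (line_emb l).
  move=> x y; rewrite /line_emb.
  case: (part x =P i) => xi; case: (part y =P i) => yi; try (by case: ifP).
    by case=> /ffunP/(_ t); rewrite !ffunE lt.
  case: (part x =P j) => xj; case: (part y =P j) => yj //; last by case.
  by case=> /ffunP/(_ t); rewrite !ffunE lt.
have newE x y : new_adj (line_emb l x) (line_emb l y) -> adj x y.
  rewrite /line_emb; case: (part x == i); case: (part y == i);
    case: (part x == j); case: (part y == j) => //=;
    by move/forallP/(_ t); rewrite !ffunE lt /= => /andP[].
split=> // x y; apply/idP/idP => [/or3P[|/newE//|/newE]|xy].
- case/existsP => l' /existsP[x' /existsP[y' /and4P[/eqP ex /eqP ey xy o]]].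
  have out z z' : outer z' -> line_emb l z = line_emb l' z' -> z = z' /\ l = l'.
    case/andP => /negbTE n1 /negbTE n2; rewrite /line_emb n1 n2.
    by do 2![case: ifP => // _]; case.
  case/orP: o => o.
    by have [E1 E2] := out _ _ o ex; rewrite E1; rewrite -E2 in ey; rewrite (inj _ _ ey).
  by have [E1 E2] := out _ _ o ey; rewrite E1; rewrite -E2 in ex; rewrite (inj _ _ ex).
- by rewrite adj_sym.
have crossE u v : adj u v -> part u = i -> part v = j ->
    new_adj (line_emb l u) (line_emb l v).
  move=> uv ui vj; rewrite /line_emb ui vj !eqxx [j == i]eq_sym (negbTE ij) /=.
  apply/forallP => t'; rewrite !ffunE; case: (l t') => [[a Ha]|] /=; first by [].
  by rewrite uv ui vj !eqxx.
rewrite /= /power_adj; case: (boolP (outer x || outer y)) => [o|].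
  apply/orP; left; apply/existsP; exists l; apply/existsP; exists x.
  by apply/existsP; exists y; rewrite !eqxx xy.
rewrite negb_or /outer !negb_and !negbK => /andP[px py].
have := part_adj xy.
case/orP: px => /eqP px; case/orP: py => /eqP py; rewrite px py ?eqxx // => _.
  by rewrite crossE // orbT.
by rewrite [X in [|| _, _ | X]]crossE ?orbT // adj_sym.
Qed.

End PartitePower.

Definition proper_parts (P : sgraph) (J : finType) (part : P -> J) :=
  forall x y : P, adj x y -> part x != part y.

Definition mono_between r (P P' : sgraph) (J : finType) (part : P -> J)
    (c : {set P'} -> 'I_r) (f : P -> P') (i j : J) :=
  exists k, forall x y, adj x y -> part x = i -> part y = j -> c [set f x; f y] = k.

(** A word of crossing edges spans one edge of the power graph and takes its colour; a monochromatic
    line of words then gives the copy of [P]. For [i = j] there is nothing to make monochromatic. *)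
Lemma partite_lemma r (P : sgraph) (J : finType) (part : P -> J) (i j : J) :
  0 < r -> proper_parts part -> exists (P' : sgraph) (part' : P' -> J), proper_parts part' /\
    forall c : {set P'} -> 'I_r, exists f : P -> P',
      [/\ embedding f, forall x, part' (f x) = part x & mono_between part c f i j].
Proof.
move=> r_gt0 proper; have [<-|ij] := eqVneq i j.
  exists P, part; split=> // c; exists id; split=> //; first by split.
  exists (Ordinal r_gt0).
  by move=> x y /proper + xi yi; rewrite xi yi eqxx.
have [I HI] := Hales_Jewett (crossing part i j) 'I_r.
exists (power_graph I ij proper), (@power_part _ _ part i j I); split.
  by move=> x y; apply: power_adj_part.
move=> c.
pose ends (e : {ffun I -> crossing part i j}) : {set power_graph I ij proper} :=
  [set inl (true, [ffun t => (val (e t)).1]); inl (false, [ffun t => (val (e t)).2])].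
have [l [act mono]] := HI (fun e => c (ends e)).
exists (line_emb l); split; first exact: line_emb_embedding.
  exact: power_part_line.
have E x y (xy : adj x y) (xi : part x = i) (yj : part y = j) :
    exists a, [set line_emb l x; line_emb l y] = ends (line_pt l a).
  have h : [&& adj (x, y).1 (x, y).2, part (x, y).1 == i & part (x, y).2 == j].
    by rewrite /= xy xi yj !eqxx.
  exists (exist _ (x, y) h); rewrite /ends /line_emb xi yj !eqxx eq_sym (negbTE ij).
  congr ([set inl (true, _); inl (false, _)]); apply/ffunP => t;
    by rewrite !ffunE; case: (l t).
case: (pickP (fun e : P * P => [&& adj e.1 e.2, part e.1 == i & part e.2 == j])).
  case=> x0 y0 /and3P[/= xy0 /eqP xi0 /eqP yj0].
  exists (c [set line_emb l x0; line_emb l y0]) => x y xy xi yj.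
  have [a ->] := E _ _ xy xi yj; have [b ->] := E _ _ xy0 xi0 yj0.
  by apply: mono; rewrite mem_enum.
move=> none; exists (Ordinal r_gt0) => x y xy xi yj.
by have := none (x, y); rewrite /= xy xi yj !eqxx.
Qed.

Lemma embedding_comp (F G H : sgraph) (f : F -> G) (g : G -> H) :
  embedding f -> embedding g -> embedding (g \o f).
Proof.
move=> [fi fm] [gi gm]; split; first exact: inj_comp.
by move=> x y; rewrite /= gm fm.
Qed.

Lemma imset_pair (A B : finType) (f : A -> B) x y : f @: [set x; y] = [set f x; f y].
Proof. by rewrite imsetU !imset_set1. Qed.

Lemma partite_construction r (J : finType) (s : seq (J * J)) (P : sgraph) (part : P -> J) :
  0 < r -> proper_parts part -> exists (P' : sgraph), forall c : {set P'} -> 'I_r,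
    exists2 f : P -> P', embedding f &
      forall e, e \in s -> mono_between part c f e.1 e.2.
Proof.
move=> r_gt0 proper.
suff [P' [part' [_ H]]] : exists (P' : sgraph) (part' : P' -> J), proper_parts part' /\
    forall c : {set P'} -> 'I_r, exists f : P -> P',
      [/\ embedding f, forall x, part' (f x) = part x &
          forall e, e \in s -> mono_between part c f e.1 e.2].
  by exists P' => c; have [f []] := H c; exists f.
elim: s P part proper => [|[i j] s IH] P part proper.
  by exists P, part; split=> // c; exists id; split=> //; split.
have [P1 [part1 [proper1 H1]]] := partite_lemma i j r_gt0 proper.
have [P2 [part2 [proper2 H2]]] := IH P1 part1 proper1.
exists P2, part2; split=> // c.
have [f2 [emb2 p2 m2]] := H2 c.
(* [P1] is coloured by pulling [c] back along [f2], so the colour found there survives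
   composition. *)
have [f1 [emb1 p1 [k1 m1]]] := H1 (fun S => c (f2 @: S)).
exists (f2 \o f1); split; first exact: embedding_comp.
  by move=> x; rewrite /= p2 p1.
move=> e; rewrite inE => /orP[/eqP->|/m2[k mk]].
  by exists k1 => x y xy xi yj; rewrite -(m1 x y) // imset_pair.
exists k => x y xy xi yj; apply: mk; rewrite ?p1 //.
by case: emb1 => _ ->.
Qed.

(** The starting graph has, for each map [F -> 'I_L], the edges of [F] whose ends get different
    values, the values being the parts. After the partite construction colours depend only on the
    pair of parts, and Ramsey's theorem on the parts selects an injective map. *)
Theorem induced_Ramsey (F : sgraph) r : 0 < r -> exists R : sgraph,
  forall c : {set R} -> 'I_r, exists2 f : F -> R, embedding f &
    exists k, forall x y, adj x y -> c [set f x; f y] = k.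
Proof.
move=> r_gt0; have [L HL] := Ramsey_pairs F r.
pose adj0 (p q : {ffun F -> 'I_L} * F) :=
  [&& p.1 == q.1, adj p.2 q.2 & p.1 p.2 != q.1 q.2].
have sym0 : symmetric adj0.
  by move=> p q; rewrite /adj0 eq_sym adj_sym [p.1 _ == _]eq_sym.
have irr0 : irreflexive adj0 by move=> p; rewrite /adj0 adj_irr andbF.
pose P := SGraph sym0 irr0.
have proper : @proper_parts P 'I_L (fun p => p.1 p.2) by move=> x y /and3P[].
have [R HR] := partite_construction (enum {: 'I_L * 'I_L}) r_gt0 proper.
exists R => c; have [f [finj fmono] mono] := HR c.
(* A pair of parts takes the colour of any edge between them, and an arbitrary colour if there is
   none. *)
pose col (S : {set 'I_L}) := if [pick e : P * P | adj e.1 e.2 &&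
    ([set e.1.1 e.1.2; e.2.1 e.2.2] == S)] is Some e
  then c [set f e.1; f e.2] else Ordinal r_gt0.
have colE (p q : P) : adj p q -> col [set p.1 p.2; q.1 q.2] = c [set f p; f q].
  move=> pq; rewrite /col; case: pickP => [[p' q'] /= /andP[pq' /eqP E]|]; last first.
    by move/(_ (p, q))/negP; case; rewrite eqxx andbT.
  have npq := proper _ _ pq; have npq' := proper _ _ pq'.
  have [k Hk] := mono (p.1 p.2, q.1 q.2) (mem_enum _ _).
  have pin : p'.1 p'.2 \in [set p.1 p.2; q.1 q.2] by rewrite -E set21.
  have qin : q'.1 q'.2 \in [set p.1 p.2; q.1 q.2] by rewrite -E set22.
  rewrite (Hk p q) //; move: pin qin npq'; rewrite !inE.
  case/orP=> /eqP ep /orP[]/eqP eq; rewrite ep eq ?eqxx // => _.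
    exact: Hk.
  by rewrite setUC; apply: Hk; rewrite // adj_sym.
have [k [g [ginj gk]]] := HL col.
exists (fun x => f ([ffun x => g x], x)).
  split=> [x y /finj [] //|x y]; rewrite fmono /= /adj0 /= eqxx /= !ffunE.
  case xy: (adj x y) => //=; rewrite (inj_eq ginj); apply/eqP => e.
  by rewrite e adj_irr in xy.
exists k => x y xy; rewrite -colE /=; last first.
  rewrite /adj0 /= eqxx xy /= !ffunE (inj_eq ginj).
  by apply: contraTneq xy => ->; rewrite adj_irr.
by rewrite !ffunE; apply: gk; apply: contraTneq xy => ->; rewrite adj_irr.
Qed.

(** * Containers for weighted hypergraphs *)

Section Containers.
Variable T : finType.
Implicit Types (w A : {set T} -> nat) (X V S U C I P : {set T}).

Definition wdeg w U := \sum_(S : {set T} | U \subset S) w S.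
Definition wtot w := \sum_(S : {set T}) w S.
Definition uniform k w := forall S, 0 < w S -> #|S| = k.
Definition supported X w := forall S, 0 < w S -> S \subset X.
Definition indep w I := forall S, 0 < w S -> ~~ (S \subset I).
(* With [p = s / M], this is the codegree condition
   [deg U <= K * p ^ (#|U| - 1) * wtot w / M]. *)
Definition spread M s K w :=
  forall U, U != set0 -> wdeg w U * M ^ #|U| <= K * s ^ #|U|.-1 * wtot w.

Lemma sum_wdeg1 w X k : uniform k w -> supported X w ->
  \sum_(v in X) wdeg w [set v] = k * wtot w.
Proof.
move=> unif supp; rewrite /wdeg /wtot big_distrr /=.
rewrite (exchange_big_dep xpredT) //=; apply: eq_bigr => S _.
have [->|w0] := posnP (w S); first by rewrite big1 ?muln0.
rewrite sum_nat_const -(unif _ w0); congr (_ * _); apply: eq_card => v.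
rewrite unfold_in sub1set; case vS: (v \in S); rewrite ?andbF // andbT.
by rewrite (subsetP (supp _ w0)).
Qed.

Lemma sum_wdeg A k : uniform k A ->
  \sum_(U : {set T}) wdeg A U = 2 ^ k * wtot A.
Proof.
move=> unif; rewrite /wdeg /wtot big_distrr /=.
rewrite (exchange_big_dep xpredT) //=; apply: eq_bigr => S _.
have [->|w0] := posnP (A S); first by rewrite big1 ?muln0.
rewrite sum_nat_const -(unif _ w0) -card_powerset; congr (_ * _).
by apply: eq_card => v; rewrite unfold_in powersetE.
Qed.

Section Step.
Variables (w : {set T} -> nat) (X : {set T}) (M s K k : nat).
Let W := wtot w.
Let K2 := 4 * k.+1 * 2 ^ k * K ^ 2.
Hypotheses (unif : uniform k.+1 w) (supp : supported X w) (W_gt0 : 0 < W).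
Hypotheses (s_gt0 : 0 < s) (K_gt0 : 0 < K) (k_gt0 : 0 < k).
Hypotheses (XM : #|X| <= M) (sM : s * (2 * K) <= M) (sprd : spread M s K w).

Let M_gt0 : 0 < M. Proof. by apply: leq_trans sM; rewrite !muln_gt0 s_gt0 K_gt0. Qed.

(* [A] collects the links of the vertices chosen so far. A set is saturated once its
   degree in [A] reaches the largest value allowed for [A] to be spread again; links
   through saturated sets are discarded, and few edges are lost thereby. *)
Definition saturated A U :=
  (U != set0) && (K2 * s ^ #|U| * W <= wdeg A U * M ^ #|U|.+1).
Definition unsaturated A S := [forall U : {set T}, (U \subset S) ==> ~~ saturated A U].
Definition usefuldeg A v := \sum_(S : {set T} | (v \in S) && unsaturated A (S :\ v)) w S.
Definition addlink A v S :=
  A S + (if (v \notin S) && unsaturated A S then w (v |: S) else 0).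

Lemma wtot_addlink A v : wtot (addlink A v) = wtot A + usefuldeg A v.
Proof.
rewrite /wtot /addlink big_split /=; congr (_ + _); rewrite -big_mkcond /=.
rewrite /usefuldeg [RHS](reindex_onto (fun S => v |: S) (fun S => S :\ v)) /=; last first.
  by move=> S /andP[vS _]; rewrite setD1K.
apply: eq_bigl => S; rewrite setU11 /=.
case vS: (v \in S) => /=; last by rewrite setU1K ?vS // eqxx andbT.
rewrite (_ : _ == S = false) ?andbF //.
by apply/negP => /eqP e; move: vS; rewrite -e !inE eqxx.
Qed.

Lemma usefuldeg_le A v : usefuldeg A v * M <= K * W.
Proof.
have := sprd (U := [set v]); rewrite cards1 expn1 expn0 muln1 => h.
apply: leq_trans (h _); last by apply/set0Pn; exists v; rewrite inE.
rewrite leq_mul2r; apply/orP; right; rewrite /usefuldeg /wdeg big_mkcondr /=.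
rewrite [leqRHS](eq_bigl (fun S => v \in S)) => [|S]; last by rewrite sub1set.
by apply: leq_sum => S _; case: ifP.
Qed.

(** A saturated [U] gains nothing. An unsaturated one is below the [K2] threshold, and one link adds
    at most the codegree of [v |: U], bounded through [K]. *)
Lemma wdeg_addlink A v U : U != set0 ->
  wdeg A U * M ^ #|U|.+1 <= (K2 + K) * s ^ #|U| * W ->
  wdeg (addlink A v) U * M ^ #|U|.+1 <= (K2 + K) * s ^ #|U| * W.
Proof.
move=> U0 hA; rewrite {1}/wdeg /addlink big_split /= -/(wdeg A U).
case satU: (saturated A U).
  rewrite [X in _ + X]big1 ?addn0 // => S US; case: ifP => // /andP[_].
  by move/forallP/(_ U); rewrite US satU.
case vU: (v \in U).
  rewrite [X in _ + X]big1 ?addn0 // => S US; rewrite (subsetP US) //.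
have le : \sum_(S : {set T} | U \subset S)
    (if (v \notin S) && unsaturated A S then w (v |: S) else 0) <= wdeg w (v |: U).
  rewrite -big_mkcondr /= /wdeg [leqRHS](bigID (fun S : {set T} => U \subset S :\ v)) /=.
  apply: leq_trans (leq_addr _ _).
  rewrite [leqRHS](reindex_onto (fun S => v |: S) (fun S => S :\ v)) /=; last first.
    by move=> S /andP[vS _]; rewrite setD1K // (subsetP vS) ?setU11.
  rewrite [leqLHS]big_mkcond [leqRHS]big_mkcond; apply: leq_sum => S _.
  case: ifP => // /andP[US /andP[vS _]].
  by rewrite setUS //= setU1K // US eqxx.
move/negbT: satU; rewrite /saturated U0 /= -ltnNge => nsat.
have := sprd (U := v |: U); rewrite cardsU1 vU /= add1n /= => h.
have {h} h := h (introT (set0Pn _) (ex_intro _ v (setU11 v U))).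
rewrite mulnDl -!mulnA mulnDl !mulnA; apply: leq_add; first exact: ltnW.
by apply: leq_trans h; rewrite leq_mul2r le orbT.
Qed.

(** Invariant of the selection: each chosen vertex adds at least [W / (2 * M)] to the total, which
    after [s] choices turns the degree bound into spread. *)
Definition link_state P A :=
  [/\ uniform k A /\ supported X A, wtot A * M <= #|P| * (K * W),
      #|P| * W <= 2 * M * wtot A,
      forall U, U != set0 -> wdeg A U * M ^ #|U|.+1 <= (K2 + K) * s ^ #|U| * W
    & forall I, P \subset I -> indep w I -> indep A I].

Lemma link_state_add P A v : v \notin P -> W <= 2 * M * usefuldeg A v ->
  link_state P A -> link_state (v |: P) (addlink A v).
Proof.
move=> vP useful [[uA sA] leW geW degA indA].
have addP S : 0 < addlink A v S -> 0 < A S \/ v \notin S /\ 0 < w (v |: S).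
  rewrite /addlink; case: (posnP (A S)) => [->|]; last by left.
  by rewrite add0n; case: ifP => // /andP[vS _]; right.
split.
- split=> S /addP[|[vS wS]]; [exact: uA| |exact: sA|].
    by have := unif wS; rewrite cardsU1 vS add1n => -[].
  exact: subset_trans (subsetUr _ _) (supp wS).
- rewrite wtot_addlink cardsU1 vP /=; have := usefuldeg_le A v; lia.
- rewrite wtot_addlink cardsU1 vP /=; lia.
- by move=> U U0; apply: wdeg_addlink => //; apply: degA.
- move=> I; rewrite subUset sub1set => /andP[vI PI] indI S /addP[|[vS wS]].
    exact: indA.
  by have := indI _ wS; rewrite subUset sub1set vI.
Qed.

(** Double counting: saturated sets have large degree in [A], while all degrees in [A] sum to
    [2 ^ k * wtot A]; spread of [w] compares them with codegrees in [w]. The constant [K2] is chosen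
    for this bound. *)
Lemma saturated_weight A : uniform k A -> wtot A * M <= s * (K * W) ->
  4 * k.+1 * \sum_(U | saturated A U) wdeg w U <= W.
Proof.
move=> uA leW; set Sg := \sum_(U | _) _.
have : K2 * s * Sg <= K * M * (2 ^ k * wtot A).
  rewrite -(sum_wdeg uA) /Sg !big_distrr /= [leqRHS](bigID (saturated A)) /=.
  apply: leq_trans (leq_addr _ _); apply: leq_sum => U /andP[U0 satU].
  have := sprd U0; have : 0 < #|U| by rewrite card_gt0.
  case: #|U| satU => // l satU _ /= spU.
  have pos : 0 < M ^ l.+1 * s ^ l * W by rewrite !muln_gt0 !expn_gt0 M_gt0 s_gt0 W_gt0.
  rewrite -(leq_pmul2r pos).
  have := leq_mul satU spU; rewrite !expnS => h.
  apply: leq_trans (leq_trans _ h) _; apply: eq_leq; rewrite /W; lia.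
move=> h; have pos : 0 < s * (2 ^ k * K ^ 2).
  by rewrite !muln_gt0 s_gt0 !expn_gt0 K_gt0.
rewrite -(leq_pmul2r pos); apply: (@leq_trans (K2 * s * Sg)).
  by apply: eq_leq; rewrite /K2; lia.
apply: leq_trans h _; apply: leq_trans (_ : K * 2 ^ k * (s * (K * W)) <= _).
  apply: leq_trans (_ : K * 2 ^ k * (wtot A * M) <= _); first by apply: eq_leq; lia.
  by rewrite leq_mul2l leW orbT.
by apply: eq_leq; rewrite expnS expn1; lia.
Qed.

(** Useful edges contribute at most [W / 2]. Any other edge contains a saturated set and counts for
    at most [k.+1] vertices, so these contribute at most [W / 4]. *)
Lemma stop_weight V P A : V \subset X -> #|P| <= s -> link_state P A ->
  (forall v, v \in V -> 2 * M * usefuldeg A v < W) ->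
  \sum_(v in V) wdeg w [set v] < W.
Proof.
move=> VX Ps [[uA _] leW _ _ _] stop; rewrite ltnNge; apply/negP => big.
have sat := saturated_weight uA (leq_trans leW (leq_mul Ps (leqnn _))).
have useful : 2 * \sum_(v in V) usefuldeg A v <= W.
  rewrite -(leq_pmul2l M_gt0) mulnCA mulnA big_distrr /=.
  apply: leq_trans (_ : \sum_(v in V) W <= _); first by apply: leq_sum => v /stop/ltnW.
  rewrite sum_nat_const leq_mul2r; apply/orP; right.
  exact: leq_trans (subset_leq_card VX) XM.
have rest : \sum_(v in V) \sum_(S : {set T} | (v \in S) && ~~ unsaturated A (S :\ v)) w S
    <= k.+1 * \sum_(U | saturated A U) wdeg w U.
  rewrite /wdeg [X in _ * X](exchange_big_dep xpredT) //=.
  rewrite (exchange_big_dep xpredT) //= big_distrr /=; apply: leq_sum => S _.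
  have [->|w0] := posnP (w S); first by rewrite big1.
  rewrite !sum_nat_const mulnA leq_mul2r; apply/orP; right.
  case: (set_0Vmem [set v in V | (v \in S) && ~~ unsaturated A (S :\ v)]) => [E|[v]].
    rewrite (eq_card (B := set0)) ?cards0 // => v; rewrite -E inE.
    by rewrite unfold_in.
  rewrite inE => /and3P[_ vS /forallPn/=[U]]; rewrite negb_imply negbK => /andP[US satU].
  rewrite -(unif w0) -[leqLHS]muln1; apply: leq_mul.
    by apply: subset_leq_card; apply/subsetP => x; rewrite unfold_in => /and3P[].
  apply/card_gt0P; exists U; rewrite unfold_in satU /=.
  exact: subset_trans US (subsetDl _ _).
have split : \sum_(v in V) wdeg w [set v] = \sum_(v in V) usefuldeg A v +
  \sum_(v in V) \sum_(S : {set T} | (v \in S) && ~~ unsaturated A (S :\ v)) w S.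
  rewrite -big_split /=; apply: eq_bigr => v _; rewrite /wdeg /usefuldeg.
  rewrite [LHS](bigID (fun S : {set T} => unsaturated A (S :\ v))) /=.
  by congr (_ + _); apply: eq_bigl => S; rewrite sub1set.
move: W_gt0 big useful sat rest; rewrite split.
set a := \sum_(v in V) usefuldeg A v; set b := \sum_(v in V) _; set c := \sum_(U | _) _.
lia.
Qed.

(** Degrees in [X] sum to [k.+1 * W], less than [W] of it in [V]. A vertex has degree at most
    [K * W / M], so at least [M / K] vertices lie outside [V], of which [P] takes at most
    [s <= M / (2 * K)]. *)
Lemma stop_container V P A : V \subset X -> #|P| <= s -> link_state P A ->
  (forall v, v \in V -> 2 * M * usefuldeg A v < W) ->
  M <= 2 * K * #|X :\: (V :|: P)|.
Proof.
move=> VX Ps st stop; have small := stop_weight VX Ps st stop.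
have := sum_wdeg1 unif supp; rewrite -/W (bigID (fun v => v \in V)) /=.
rewrite (eq_bigl (fun v => v \in V)) => [eqW|v]; last first.
  by case vV: (v \in V); rewrite ?andbF // (subsetP VX).
have XV : M <= K * #|X :\: V|.
  rewrite -(leq_pmul2r W_gt0).
  apply: leq_trans (_ : M * \sum_(i in X | i \notin V) wdeg w [set i] <= _).
    rewrite leq_mul2l; apply/orP; right.
    move: small eqW W_gt0; set a := \sum_(i in V) _; set b := \sum_(i in X | _) _.
    nia.
  rewrite big_distrr /= [K * _]mulnC -mulnA -sum_nat_const.
  rewrite big_mkcond [leqRHS]big_mkcond /=; apply: leq_sum => v _.
  rewrite !inE andbC; case: ifP => // _; rewrite mulnC.
  have := sprd (U := [set v]); rewrite cards1 expn1 expn0 muln1; apply.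
  by apply/set0Pn; exists v; rewrite inE.
have : #|X :\: V| <= #|X :\: (V :|: P)| + s.
  apply: leq_trans (leq_add (leqnn _) Ps); rewrite -cardsUI.
  apply: leq_trans (leq_addr _ _); apply: subset_leq_card.
  by apply/subsetP => x; rewrite !inE negb_or; case: (x \in V); case: (x \in P); case: (x \in X).
move: sM XV; set a := #|_|; set b := #|_|; nia.
Qed.

Definition covering D (L : seq {set T}) (Q : {set T} -> Prop) :=
  (forall C, C \in L -> C \subset X /\ M <= D * #|X :\: C|) /\
  (forall I, I \subset X -> Q I -> exists2 C, C \in L & I \subset C).

(* Vertices of large useful degree are queried one by one. Each is either outside [I],
   and dropped from [V], or in [I], and put into the fingerprint [P]; after [s]
   successes the links form a spread hypergraph of smaller uniformity, still
   independent from [I], and if no vertex of large degree is left then [V :|: P] is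
   already small. *)
Lemma container_tree D B : 2 * K <= D -> 0 < B ->
  (forall A, uniform k A -> supported X A -> 0 < wtot A ->
     spread M s (2 * (K2 + K)) A ->
     exists2 L, size L <= B & covering D L (indep A)) ->
  forall n j V P A, #|V| = n -> V \subset X -> P \subset X -> [disjoint V & P] ->
    #|P| + j = s -> link_state P A ->
  exists2 L, size L <= B * n.+1 ^ j &
    covering D L (fun I => [/\ P \subset I, I \subset V :|: P & indep w I]).
Proof.
move=> KD B_gt0 rec; elim=> [|n IH] j V P A cV VX PX dVP cP st.
all: case: j cP => [|j] cP.
(* For [j = 0] the fingerprint is full: the lower bound on [wtot A] makes [A] spread with constant
   [2 * (K2 + K)], and [rec] applies. *)
1,3: rewrite addn0 in cP; case: st => [[uA sA] leW geW degA indA];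
  have A_gt0 : 0 < wtot A by move: geW; rewrite cP; case: (wtot A) => //;
    rewrite muln0 leqNgt muln_gt0 s_gt0 W_gt0.
1,2: have [|L sL [L1 L2]] := rec A uA sA A_gt0; last by
  exists L; [by rewrite expn0 muln1 | split=> // I IX [PI _ indI]; apply: L2 => //; apply: indA].
1,2: move=> U U0; have := degA U U0; have : 0 < #|U| by rewrite card_gt0.
1,2: case: #|U| => // l _ /= h; rewrite -(leq_pmul2l M_gt0) mulnCA -expnS;
  apply: leq_trans h _; rewrite cP in geW;
  have := leq_mul (leqnn ((K2 + K) * s ^ l)) geW; rewrite expnS => h';
  apply: leq_trans (leq_trans _ h') _; apply: eq_leq; lia.
- exists [:: V :|: P] => /=; first by rewrite muln_gt0 B_gt0 expn_gt0.
  split=> [C|I IX [_ IV _]]; last by exists (V :|: P); rewrite ?inE.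
  rewrite inE => /eqP->; split; first by rewrite subUset VX PX.
  apply: leq_trans (stop_container VX _ st _) _; first by lia.
    by move=> v; rewrite (card0_eq cV).
  by rewrite leq_mul2r KD orbT.
case: (boolP [exists v in V, W <= 2 * M * usefuldeg A v]) => [|noV]; last first.
  exists [:: V :|: P] => /=; first by rewrite muln_gt0 B_gt0 expn_gt0.
  split=> [C|I IX [_ IV _]]; last by exists (V :|: P); rewrite ?inE.
  rewrite inE => /eqP->; split; first by rewrite subUset VX PX.
  apply: leq_trans (stop_container VX _ st _) _; first by lia.
    by move=> v vV; move/exists_inPn/(_ v vV): noV; rewrite ltnNge.
  by rewrite leq_mul2r KD orbT.
case/exists_inP => v vV useful.
have vP : v \notin P by rewrite (disjointFr dVP).
have cV' : #|V :\ v| = n by move: cV; rewrite (cardsD1 v) vV add1n => -[].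
have sV : V :\ v \subset V := subsetDl _ _.
have VX' := subset_trans sV VX.
(* The branch with [v] outside [I] keeps the budget [j.+1]; the other branch spends one unit. *)
have [|||L1 s1 [c1 d1]] := IH j.+1 (V :\ v) P A cV' VX' PX; rewrite ?cP //.
  exact: disjointWl sV dVP.
have [||||L2 s2 [c2 d2]] := IH j (V :\ v) (v |: P) (addlink A v) cV' VX'.
- by rewrite subUset sub1set (subsetP VX).
- rewrite disjoints_subset; apply/subsetP => x; rewrite !inE => /andP[xv xV].
  by rewrite negb_or xv (disjointFr dVP).
- by rewrite cardsU1 vP; lia.
- exact: link_state_add.
exists (L1 ++ L2).
  rewrite size_cat; apply: leq_trans (leq_add s1 s2) _.
  rewrite -mulnDr leq_mul2l; apply/orP; right.
  rewrite expnS [leqRHS]expnS.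
  have : n.+1 ^ j <= n.+2 ^ j by case: j {cP s1 s2 c1 d1 c2 d2} => // j; rewrite leq_exp2r.
  nia.
split=> [C|I IX [PI IV indI]]; first by rewrite mem_cat => /orP[/c1|/c2].
case vI: (v \in I).
  have [|C CL IC] := d2 I IX; last by exists C; rewrite // mem_cat CL orbT.
  split=> //; first by rewrite subUset sub1set vI.
  by apply: subset_trans IV _; rewrite setUCA setUA setD1K.
have [|C CL IC] := d1 I IX; last by exists C; rewrite // mem_cat CL.
split=> //; apply/subsetP => x xI; move/subsetP/(_ x xI): IV.
by rewrite !inE; case: eqP => [xv|//]; rewrite -xv xI in vI.
Qed.

End Step.

Definition restrict C w S := if S \subset C then w S else 0.

End Containers.

(** Induction on the uniformity, passing to the links collected by [container_tree]. In uniformity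
    one the vertices of weight zero form the only container needed. *)
Lemma container_step k K : 0 < K -> exists2 D, 0 < D &
  forall (T : finType) (X : {set T}) M s (w : {set T} -> nat),
    #|X| <= M -> 0 < s -> s * D <= M -> uniform k.+1 w -> supported X w ->
    0 < wtot w -> spread M s K w ->
  exists2 L, size L <= M.+1 ^ (s * k) & covering X M D L (indep w).
Proof.
elim: k K => [|k IH] K K_gt0.
  exists K => // T X M s w XM s_gt0 sM unif supp W_gt0 sprd.
  exists [:: [set v in X | w [set v] == 0]]; first by rewrite muln0.
  split=> [C|I IX indI]; last first.
    exists [set v in X | w [set v] == 0]; rewrite ?inE //.
    apply/subsetP => v vI; rewrite inE (subsetP IX) //=.
    by rewrite -leqn0 leqNgt; apply/negP => /indI; rewrite sub1set vI.
  rewrite inE => /eqP->; split; first by apply/subsetP => v; rewrite inE => /andP[].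
  set Y := X :\: _.
  have := sum_wdeg1 unif supp; rewrite mul1n => eqW.
  have deg1 v : wdeg w [set v] = w [set v].
    rewrite /wdeg (bigD1 [set v]) //= big1 ?addn0 // => S /andP[vS neq].
    apply: contra_neq_eq neq; rewrite -lt0n => /unif cS; apply/eqP; rewrite eq_sym.
    by rewrite eqEcard vS cS cards1.
  rewrite -(leq_pmul2r W_gt0) -{1}eqW big_distrr /= [K * _]mulnC -mulnA -sum_nat_const.
  rewrite big_mkcond [leqRHS]big_mkcond; apply: leq_sum => v _.
  rewrite /Y !inE deg1; case: (v \in X) => //=; rewrite ?andbF //= andbT.
  case: eqP => [->|_] /=; first by rewrite muln0.
  have := sprd [set v]; rewrite cards1 expn1 expn0 muln1 deg1 mulnC; apply.
  by apply/set0Pn; exists v; rewrite inE.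
pose K' := 2 * (4 * k.+2 * 2 ^ k.+1 * K ^ 2 + K).
have [|D D_gt0 HD] := IH K'; first by rewrite /K'; lia.
exists (2 * K + D); first by lia.
move=> T X M s w XM s_gt0 sM unif supp W_gt0 sprd.
have sK : s * (2 * K) <= M by nia.
have rec (A : {set T} -> nat) : uniform k.+1 A -> supported X A -> 0 < wtot A ->
     spread M s K' A -> exists2 L, size L <= M.+1 ^ (s * k) &
       covering X M (2 * K + D) L (indep A).
  move=> uA sA A0 spA; have [|L sL [L1 L2]] := HD T X M s A XM s_gt0 _ uA sA A0 spA.
    by nia.
  exists L => //; split=> // C /L1[CX le]; split=> //; apply: leq_trans le _.
  by rewrite leq_mul2r leq_addl orbT.
have B_gt0 : 0 < M.+1 ^ (s * k) by rewrite expn_gt0.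
have [||||L sL [L1 L2]] := container_tree unif supp W_gt0 s_gt0 K_gt0 (ltn0Sn k) XM sK sprd
  (leq_addr D (2 * K)) B_gt0 rec (j := s) (P := set0) (A := fun _ => 0) erefl (subxx X).
- exact: sub0set.
- by rewrite disjoint_sym disjoints_subset sub0set.
- by rewrite cards0.
- split=> [|||U _|//]; [by split| | | ]; rewrite ?cards0 //.
    by rewrite /wtot big1.
  by rewrite /wdeg big1.
exists L; last first.
  by split=> // I IX indI; apply: L2 => //; rewrite sub0set setU0.
apply: leq_trans sL _; rewrite mulnS addnC expnD leq_mul2l; apply/orP; right.
by rewrite leq_exp2r.
Qed.

(** [container_step] is repeated inside each container carrying more than [wtot w / eta], where the
    restricted weight is spread with constant [eta * K]. A round removes at least [M / D] vertices,
    so [D] rounds suffice. *)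
Theorem containers k K eta : 0 < K -> 0 < eta -> exists2 D, 0 < D &
  forall (T : finType) (X : {set T}) M s (w : {set T} -> nat),
    #|X| <= M -> 0 < s -> s * D <= M -> uniform k.+1 w -> supported X w ->
    0 < wtot w -> spread M s K w ->
  exists2 L : seq {set T}, size L <= M.+1 ^ (s * (k * D)) &
    (forall C, C \in L -> C \subset X /\ eta * wtot (restrict C w) <= wtot w) /\
    (forall I : {set T}, I \subset X -> indep w I -> exists2 C, C \in L & I \subset C).
Proof.
move=> K_gt0 eta_gt0; have [|D D_gt0 HD] := @container_step k (eta * K).
  by rewrite muln_gt0 eta_gt0.
exists D => // T X M s w XM s_gt0 sM unif supp W_gt0 sprd.
have M_gt0 : 0 < M by apply: leq_trans sM; rewrite muln_gt0 s_gt0.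
suff main t (Y : {set T}) : Y \subset X -> #|Y| * D <= t * M ->
  exists2 L : seq {set T}, size L <= M.+1 ^ (s * (k * t)) &
    (forall C, C \in L -> C \subset X /\ eta * wtot (restrict C w) <= wtot w) /\
    (forall I : {set T}, I \subset Y -> indep w I -> exists2 C, C \in L & I \subset C).
  by apply: main => //; rewrite mulnC leq_mul2l XM orbT.
elim: t Y => [|t IHt] Y YX cY; have [few|many] := leqP (eta * wtot (restrict Y w)) (wtot w).
1,3: exists [:: Y]; first by rewrite expn_gt0.
1,2: split=> [C|I IY _]; [by rewrite inE => /eqP-> | by exists Y; rewrite ?inE].
- suff : wtot (restrict Y w) = 0 by move=> E; rewrite E muln0 in many.
  rewrite /wtot big1 // => S _; rewrite /restrict; case: ifP => // SY.
  apply/eqP; rewrite -leqn0 leqNgt; apply/negP => /unif cS.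
  have := subset_leq_card SY; rewrite cS; move: cY; rewrite mul0n leqn0 muln_eq0.
  by case/orP => /eqP E; rewrite E // in D_gt0 *.
have [|||||||L sL [L1 L2]] := HD T Y M s (restrict Y w).
- exact: leq_trans (subset_leq_card YX) XM.
- by [].
- by [].
- by move=> S; rewrite /restrict; case: ifP => // _; apply: unif.
- by move=> S; rewrite /restrict; case: ifP.
- by case: posnP many => // ->; rewrite muln0.
- move=> U U0; apply: leq_trans (_ : wdeg w U * M ^ #|U| <= _).
    rewrite leq_mul2r; apply/orP; right; apply: leq_sum => S _.
    by rewrite /restrict; case: ifP.
  apply: leq_trans (sprd U U0) _; apply: leq_trans (leq_mul (leqnn _) (ltnW many)) _.
  by apply: eq_leq; lia.
have rec C : C \in L -> exists LC : seq {set T}, [/\ size LC <= M.+1 ^ (s * (k * t)),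
    (forall C, C \in LC -> C \subset X /\ eta * wtot (restrict C w) <= wtot w) &
    (forall I : {set T}, I \subset C -> indep w I -> exists2 C, C \in LC & I \subset C)].
  move=> /L1[CY]; rewrite cardsD (setIidPr CY) => le.
  have := subset_leq_card CY => cC.
  have [||L' ? [? ?]] := IHt C; [exact: subset_trans CY YX| |by exists L'].
  nia.
have {rec} [f Hf] : exists f : {set T} -> seq {set T}, forall C, C \in L ->
  [/\ size (f C) <= M.+1 ^ (s * (k * t)),
    (forall C', C' \in f C -> C' \subset X /\ eta * wtot (restrict C' w) <= wtot w) &
    (forall I : {set T}, I \subset C -> indep w I -> exists2 C', C' \in f C & I \subset C')].
  have tot (C : {set T}) : exists LC : seq {set T}, C \in L -> [/\ size LC <= M.+1 ^ (s * (k * t)),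
    (forall C', C' \in LC -> C' \subset X /\ eta * wtot (restrict C' w) <= wtot w) &
    (forall I : {set T}, I \subset C -> indep w I -> exists2 C', C' \in LC & I \subset C')].
    case: (boolP (C \in L)) => [/rec[LC ?]|_]; first by exists LC.
    by exists [::].
  by have := @fin_all_exists {set T} (fun _ => seq {set T}) _ tot.
exists (flatten (map f L)).
  rewrite size_flatten /shape -map_comp sumnE big_map big_seq.
  apply: leq_trans (_ : \sum_(C <- L | C \in L) M.+1 ^ (s * (k * t)) <= _).
    by apply: leq_sum => C /Hf[].
  rewrite -big_seq big_const_seq count_predT iter_addn_0 mulnC.
  apply: leq_trans (leq_mul sL (leqnn _)) _.
  by rewrite -expnD -mulnDr -mulnS.
split=> [C /flatten_mapP[C0 /Hf[_ H _]] /H //|I IY indI].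
have [|C CL IC] := L2 I IY.
  by move=> S; rewrite /restrict; case: ifP => // _; apply: indI.
have [_ _ H] := Hf _ CL; have [C' C'f IC'] := H I IC indI.
by exists C' => //; apply/flatten_mapP; exists C.
Qed.

(** * Copies in a blow-up *)

Lemma card_ffun_constrained (A B : finType) (S : {set A}) (B0 : A -> {set B}) m :
  (forall x, x \in S -> #|B0 x| = m) ->
  #|[set g : {ffun A -> B} | [forall (x | x \in S), g x \in B0 x]]| =
    m ^ #|S| * #|B| ^ (#|A| - #|S|).
Proof.
move=> cB0; pose E x := if x \in S then mem (B0 x) else mem [set: B].
rewrite (eq_card (B := family E)) => [|g]; last first.
  rewrite inE; apply/forall_inP/familyP => [h x|h x xS].
    by rewrite /E; case: ifP => [/h//|_]; rewrite inE.
  by have := h x; rewrite /E xS.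
rewrite card_family foldrE big_map big_enum /=.
rewrite (bigID (mem S)) /= (eq_bigr (fun=> m)) => [|x xS]; last by rewrite /E xS cB0.
rewrite [X in _ * X](eq_bigr (fun=> #|B|)) => [|x /negbTE xS]; last first.
  by rewrite /E xS cardsT.
rewrite !prod_nat_const; congr (_ * _ ^ _).
by rewrite -(cardsC S) addKn; apply: eq_card => x; rewrite !inE.
Qed.

Lemma card_bigcup_le (J T : finType) (P : pred J) (G : J -> {set T}) :
  #|\bigcup_(j | P j) G j| <= \sum_(j | P j) #|G j|.
Proof.
elim/big_rec2: _ => [|j n S _ le]; first by rewrite cards0.
by apply: leq_trans (leq_card_setU _ _) _; rewrite leq_add2l.
Qed.

Section Blowup.
Variables (R : sgraph) (N : nat).

Definition blowup_adj (p q : R * 'I_N) := adj p.1 q.1.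
Lemma blowup_sym : symmetric blowup_adj.
Proof. by move=> p q; apply: adj_sym. Qed.
Lemma blowup_irr : irreflexive blowup_adj.
Proof. by move=> p; apply: adj_irr. Qed.
Definition blowup := SGraph blowup_sym blowup_irr.

Variable F : sgraph.

Definition canonical_copy : finType := ({ffun F -> R} * {ffun F -> 'I_N})%type.
Definition copy_fun (phi : canonical_copy) (x : F) : blowup := (phi.1 x, phi.2 x).
Definition is_emb (f : {ffun F -> R}) :=
  [forall x, forall y, ((f x == f y) ==> (x == y)) && (adj (f x) (f y) == adj x y)].

Lemma is_embP (f : {ffun F -> R}) : reflect (embedding (f : F -> R)) (is_emb f).
Proof.
apply: (iffP forallP) => [h|[inj mono] x].
  split=> x y; have /forallP/(_ y)/andP[h1 h2] := h x; last exact/eqP.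
  by move/eqP => e; apply/eqP; move: h1; rewrite e.
apply/forallP => y; rewrite mono eqxx andbT; apply/implyP => /eqP/inj->.
exact: eqxx.
Qed.

Definition copy_edges (phi : canonical_copy) : {set {set blowup}} :=
  [set copy_fun phi @: e | e : {set F} in edges F].

Definition copies := [set phi : canonical_copy | is_emb phi.1].
Definition num_emb := #|[set f | is_emb f]|.

(** Maps are counted, since several may have the same edge set. *)
Definition copy_weight (S : {set {set blowup}}) :=
  #|[set phi in copies | copy_edges phi == S]|.

Lemma copy_inj phi : phi \in copies -> injective (copy_fun phi).
Proof. by rewrite inE => /is_embP[inj _] x y [/inj]. Qed.

Lemma copy_edges_sub phi : phi \in copies -> copy_edges phi \subset edges blowup.
Proof.
rewrite inE => /is_embP[_ mono]; apply/subsetP => _ /imsetP[e /edgesP[x [y [xy ->]]] ->].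
by rewrite imset_pair in_edges /= /blowup_adj /= mono.
Qed.

Lemma card_copy_edges phi : phi \in copies -> #|copy_edges phi| = #|edges F|.
Proof. by move=> /copy_inj inj; rewrite card_imset //; apply: imset_inj. Qed.

Lemma copy_weight_gt0 S : 0 < copy_weight S -> exists2 phi, phi \in copies & copy_edges phi = S.
Proof. by case/card_gt0P => phi; rewrite inE => /andP[? /eqP ?]; exists phi. Qed.

Lemma copy_weight_uniform : uniform #|edges F| copy_weight.
Proof. by move=> S /copy_weight_gt0[phi phiC <-]; apply: card_copy_edges. Qed.

Lemma copy_weight_supported : supported (edges blowup) copy_weight.
Proof. by move=> S /copy_weight_gt0[phi phiC <-]; apply: copy_edges_sub. Qed.

Lemma sum_copy_weight (Q : pred {set {set blowup}}) :
  \sum_(S | Q S) copy_weight S = #|[set phi in copies | Q (copy_edges phi)]|.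
Proof.
rewrite -sum1_card (partition_big copy_edges Q) /= => [|phi]; last first.
  by rewrite inE => /andP[].
apply: eq_bigr => S QS; rewrite /copy_weight -sum1_card; apply: eq_bigl => phi.
rewrite !inE; case: eqP => [->|_]; last by rewrite !andbF.
by rewrite QS !andbT.
Qed.

Lemma wtot_copy_weight : wtot copy_weight = num_emb * N ^ #|F|.
Proof.
rewrite /wtot sum_copy_weight.
rewrite (_ : [set _ in _ | _] = setX [set f | is_emb f] [set: {ffun F -> 'I_N}]).
  by rewrite cardsX cardsT card_ffun card_ord.
by apply/setP => -[f g]; rewrite !inE.
Qed.

Lemma card_edges_blowup : #|edges blowup| <= (#|R| * N) ^ 2.
Proof.
apply: leq_trans (leq_imset_card _ _) _.
by apply: leq_trans (max_card _) _; rewrite !card_prod card_ord mulnn.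
Qed.

Lemma card_cover_edges (G : sgraph) (U : {set {set G}}) : U \subset edges G ->
  #|cover U| <= 2 * #|U|.
Proof.
move=> UE; apply: leq_trans (leq_card_cover U) _.
rewrite mulnC -sum_nat_const; apply: leq_sum => e eU.
by rewrite (card_edge (subsetP UE _ eU)).
Qed.

(* A copy through [U] maps some [X] onto [U], and is free outside the vertices
   of [X], of which there are at least [2 + (#|U| - 1) * b / a]. *)
Lemma copy_degree a b q U : 0 < q -> hereditarily_sparse a b (edges F) -> q ^ a = N ->
  U != set0 -> wdeg copy_weight U * (q ^ b) ^ #|U|.-1 * N ^ 2 <=
    2 ^ #|edges F| * (2 * #|edges F|).+1 ^ #|F| * (num_emb * N ^ #|F|).
Proof.
move=> q_gt0 sp qN U0; rewrite /wdeg sum_copy_weight; set A := [set _ in _ | _].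
have [->|[phi0]] := set_0Vmem A; first by rewrite cards0.
rewrite inE => /andP[phi0C Uphi0].
have UE : U \subset edges blowup := subset_trans Uphi0 (copy_edges_sub phi0C).
have cU : #|U| <= #|edges F| by rewrite -(card_copy_edges phi0C) subset_leq_card.
(* A copy sending [X] onto [U] has at most [#|I0|] positions available for each vertex of
   [cover X]. *)
pose I0 := [set p.2 | p in cover U].
have cI0 : #|I0| <= 2 * #|edges F|.
  apply: leq_trans (leq_imset_card _ _) _.
  apply: leq_trans (card_cover_edges UE) _; by rewrite leq_mul2l cU.
pose B f (X : {set {set F}}) := [set phi : canonical_copy | (phi.1 == f) &&
  [forall (x | x \in cover X), phi.2 x \in I0]].
pose goodX (X : {set {set F}}) := (X \subset edges F) && (#|X| == #|U|).
have Asub : A \subset \bigcup_(f | is_emb f) \bigcup_(X | goodX X) B f X.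
  apply/subsetP => phi; rewrite inE => /andP[phiC Uphi].
  have emb : is_emb phi.1 by move: phiC; rewrite inE.
  apply/bigcupP; exists phi.1 => //.
  pose X := [set e in edges F | copy_fun phi @: e \in U].
  have XU : [set copy_fun phi @: e | e : {set F} in X] = U.
    apply/setP => e; apply/imsetP/idP => [[e']|eU]; first by rewrite inE => /andP[_ ?] ->.
    have /imsetP[e' e'F ee'] := subsetP Uphi _ eU.
    by exists e' => //; rewrite inE e'F -ee'.
  apply/bigcupP; exists X.
    rewrite /goodX -XU card_imset ?eqxx ?andbT; last exact/imset_inj/copy_inj.
    by apply/subsetP => e; rewrite inE => /andP[].
  rewrite inE eqxx; apply/forall_inP => x /bigcupP[e]; rewrite inE => /andP[_ eU] xe.
  apply/imsetP; exists (copy_fun phi x) => //; apply/bigcupP.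
  by exists (copy_fun phi @: e) => //; apply: imset_f.
have cB f X : goodX X ->
    #|B f X| * (q ^ b) ^ #|U|.-1 * N ^ 2 <= (2 * #|edges F|).+1 ^ #|F| * N ^ #|F|.
  case/andP => XF /eqP XU.
  have -> : B f X = setX [set f] [set g : {ffun F -> 'I_N} |
      [forall (x | x \in cover X), g x \in I0]].
    by apply/setP => -[f' g]; rewrite !inE.
  rewrite cardsX cards1 mul1n (card_ffun_constrained (m := #|I0|)) // card_ord.
  have X0 : X != set0 by rewrite -card_gt0 XU card_gt0.
  have cX : #|cover X| <= #|F| := max_card _.
  have := sp X XF X0; rewrite /sparse XU => spX.
  rewrite -!mulnA; apply: leq_mul.
    apply: leq_trans (_ : (2 * #|edges F|).+1 ^ #|cover X| <= _).
      case: #|cover X| => // c; rewrite leq_exp2r //; exact: leq_trans cI0 (leqnSn _).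
    by rewrite leq_pexp2l.
  apply: leq_trans (_ : N ^ (#|F| - #|cover X|) * N ^ #|cover X| <= _); last first.
    by rewrite -expnD subnK.
  rewrite leq_mul2l; apply/orP; right; rewrite -qN -!expnM -expnD.
  by rewrite leq_pexp2l // [a * 2]mulnC.
have -> : 2 ^ #|edges F| = #|powerset (edges F)| by rewrite card_powerset.
set W := _ ^ #|F| * _ in cB *.
apply: leq_trans (_ : \sum_(f | is_emb f) \sum_(X | goodX X) W <= _).
  apply: leq_trans (_ : (\sum_(f | is_emb f) \sum_(X | goodX X) #|B f X|) *
    ((q ^ b) ^ #|U|.-1 * N ^ 2) <= _).
    rewrite -mulnA leq_mul2r; apply/orP; right.
    apply: leq_trans (subset_leq_card Asub) _.
    by apply: leq_trans (card_bigcup_le _ _) _; apply: leq_sum => f _; exact: card_bigcup_le.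
  rewrite big_distrl /=; apply: leq_sum => f _; rewrite big_distrl /=.
  by apply: leq_sum => X gX; rewrite mulnA; apply: cB.
rewrite !sum_nat_const /W (_ : #|_| = num_emb); last by rewrite /num_emb cardsE.
rewrite [X in _ <= X](_ : _ = num_emb *
    (#|powerset (edges F)| * ((2 * #|edges F|).+1 ^ #|F| * N ^ #|F|))).
  rewrite leq_mul2l; apply/orP; right; rewrite leq_mul2r; apply/orP; right.
  by apply: subset_leq_card; apply/subsetP => X; rewrite unfold_in powersetE => /andP[].
by rewrite mulnCA !mulnA.
Qed.


Definition transversal_map (g : {ffun R -> 'I_N}) (x : R) : blowup := (x, g x).

Lemma card_transversal_through d : d \in edges blowup ->
  #|[set g | [exists e : {set R}, transversal_map g @: e == d]]| * N ^ 2 <= N ^ #|R|.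
Proof.
case/edgesP => p [q [pq ->]]; have npq : p.1 != q.1.
  by apply: contraTneq pq => e; rewrite /= /blowup_adj e adj_irr.
pose B0 x := if x == p.1 then [set p.2] else [set q.2].
apply: leq_trans (_ : #|[set g : {ffun R -> 'I_N} |
    [forall (x | x \in [set p.1; q.1]), g x \in B0 x]]| * N ^ 2 <= _).
  rewrite leq_mul2r; apply/orP; right; apply: subset_leq_card.
  apply/subsetP => g; rewrite !inE => /existsP[e /eqP E]; apply/forall_inP => x.
  have on z : z \in [set p; q] -> g z.1 = z.2 by rewrite -E => /imsetP[y _ ->].
  rewrite !inE /B0 => /orP[]/eqP->; first by rewrite eqxx inE on ?set21.
  by rewrite eq_sym (negbTE npq) inE on ?set22.
rewrite (card_ffun_constrained (m := 1)) => [|x _]; last by rewrite /B0; case: ifP; rewrite cards1.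
rewrite cards2 npq card_ord exp1n mul1n -expnD subnK //.
by have := max_card (mem [set p.1; q.1]); rewrite cards2 npq.
Qed.

Lemma card_transversal_extending phi : phi \in copies ->
  #|[set g : {ffun R -> 'I_N} | [forall x, g (phi.1 x) == phi.2 x]]| * N ^ #|F| = N ^ #|R|.
Proof.
rewrite inE => /is_embP[inj _].
pose S := [set phi.1 x | x in F]; pose B0 y := [set phi.2 x | x in [set x | phi.1 x == y]].
have cS : #|S| = #|F| by rewrite card_imset.
have B0E x : B0 (phi.1 x) = [set phi.2 x].
  rewrite /B0 (_ : [set _ | _] = [set x]) ?imset_set1 //.
  by apply/setP => y; rewrite !inE (inj_eq inj).
have -> : [set g : {ffun R -> 'I_N} | [forall x, g (phi.1 x) == phi.2 x]] =
    [set g : {ffun R -> 'I_N} | [forall (y | y \in S), g y \in B0 y]].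
  apply/setP => g; rewrite !inE; apply/forallP/forall_inP => [h y /imsetP[x _ ->]|h x].
    by rewrite B0E inE.
  have xS : phi.1 x \in S by apply: imset_f.
  by have := h _ xS; rewrite B0E inE.
rewrite (card_ffun_constrained (m := 1)) => [|_ /imsetP[x _ ->]]; last by rewrite B0E cards1.
by rewrite card_ord exp1n mul1n -expnD cS subnK // -cS max_card.
Qed.

(** Averaging over transversal copies of [R]: one with all edges in the [C i] contains a copy of [F]
    inside a single [C i]. Few copies are available, so at most half of the transversals are of this
    kind; the others use an edge outside, and each edge lies in a proportion at most [1 / N ^ 2] of
    them all. *)
Lemma supersaturation r (C : 'I_r -> {set {set blowup}}) : 0 < N -> 0 < r -> 0 < num_emb ->
  (forall c : {set R} -> 'I_r, exists2 f : F -> R, embedding f &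
    exists k, forall x y, adj x y -> c [set f x; f y] = k) ->
  (forall i, 2 * r * num_emb * wtot (restrict (C i) copy_weight) <= wtot copy_weight) ->
  N ^ 2 <= 2 * #|edges blowup :\: \bigcup_i C i|.
Proof.
move=> N_gt0 r_gt0 ne_gt0 ramsey few; set D := _ :\: _.
pose bad := \bigcup_(d in D) [set g | [exists e : {set R}, transversal_map g @: e == d]].
pose in_C i := [set phi in copies | copy_edges phi \subset C i].
pose good := \bigcup_i \bigcup_(phi in in_C i)
  [set g : {ffun R -> 'I_N} | [forall x, g (phi.1 x) == phi.2 x]].
have all_g : [set: {ffun R -> 'I_N}] \subset bad :|: good.
  apply/subsetP => g _; rewrite inE; case: (boolP (g \in bad)) => //= ngb.
  have inC e : e \in edges R -> exists i, transversal_map g @: e \in C i.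
    move=> eR; have : transversal_map g @: e \notin D.
      apply: contra ngb => eD; apply/bigcupP; exists (transversal_map g @: e) => //.
      by rewrite inE; apply/existsP; exists e.
    rewrite inE negb_and negbK; case/orP => [/bigcupP[i _ ?]|]; first by exists i.
    case/edgesP: eR => x [y [xy ->]]; rewrite imset_pair in_edges /= /blowup_adj /=.
    by rewrite xy.
  have [f femb [k fk]] := ramsey (fun e =>
    odflt (Ordinal r_gt0) [pick i | transversal_map g @: e \in C i]).
  have femb' : is_emb [ffun x => f x].
    apply/is_embP; case: femb => inj mono; split=> [x y|x y]; rewrite !ffunE //.
    exact: inj.
  apply/bigcupP; exists k => //; apply/bigcupP.
  exists ([ffun x => f x], [ffun x => g (f x)]); last first.
    by rewrite inE; apply/forallP => x; rewrite !ffunE.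
  rewrite inE inE femb' /=; apply/subsetP => _ /imsetP[_ /edgesP[x [y [xy ->]]] ->].
  have fxy : [set f x; f y] \in edges R by rewrite in_edges; case: femb => _ ->.
  have := fk x y xy; case: pickP => [i iC /= <-|none]; last first.
    by have [i] := inC _ fxy; rewrite none.
  move: iC; rewrite !imset_pair /copy_fun /transversal_map /= !ffunE; exact.
have cbad : #|bad| * N ^ 2 <= #|D| * N ^ #|R|.
  apply: leq_trans (leq_mul (card_bigcup_le _ _) (leqnn _)) _.
  rewrite big_distrl -sum_nat_const; apply: leq_sum => d; rewrite inE => /andP[_ dE].
  exact: card_transversal_through.
have cgood : #|good| * N ^ #|F| <= (\sum_i #|in_C i|) * N ^ #|R|.
  apply: leq_trans (leq_mul (card_bigcup_le _ _) (leqnn _)) _.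
  rewrite !big_distrl; apply: leq_sum => i _ /=.
  apply: leq_trans (leq_mul (card_bigcup_le _ _) (leqnn _)) _.
  rewrite big_distrl -sum_nat_const; apply: leq_sum => phi; rewrite inE => /andP[phiC _].
  by apply: eq_leq; apply: card_transversal_extending.
have cin : 2 * \sum_i #|in_C i| <= N ^ #|F|.
  have rn : 0 < r * num_emb by rewrite muln_gt0 r_gt0.
  rewrite -(leq_pmul2l rn) mulnA big_distrr /=.
  apply: leq_trans (_ : \sum_(i < r) wtot copy_weight <= _); last first.
    by rewrite sum_nat_const card_ord wtot_copy_weight mulnA.
  apply: leq_sum => i _; apply: leq_trans (few i).
  rewrite /wtot -big_mkcond sum_copy_weight /= [r * _ * _]mulnC mulnA; exact: leqnn.
have tot : N ^ #|R| <= #|bad| + #|good|.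
  apply: leq_trans (leq_trans (subset_leq_card all_g) (leq_card_setU _ _)).
  by rewrite cardsT card_ffun card_ord.
have pF : 0 < N ^ #|F| by rewrite expn_gt0 N_gt0.
have pR : 0 < N ^ #|R| by rewrite expn_gt0 N_gt0.
have good_le : 2 * #|good| <= N ^ #|R|.
  rewrite -(leq_pmul2r pF) -mulnA.
  apply: leq_trans (leq_mul (leqnn 2) cgood) _; rewrite mulnA mulnC leq_mul2l.
  by rewrite cin orbT.
rewrite -(leq_pmul2r pR) -mulnA.
apply: leq_trans (leq_mul (leqnn 2) cbad); rewrite mulnA [_ * N ^ 2]mulnC leq_mul2l.
by apply/orP; right; move: tot good_le; clear; lia.
Qed.

End Blowup.

(** * Random subsets and alteration *)

Lemma expn_succ_ge n m : n ^ m.+1 + m.+1 * n ^ m <= n.+1 ^ m.+1.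
Proof.
elim: m => [|m IH]; first by rewrite !expn1 expn0 muln1 addn1.
rewrite [leqRHS]expnS; apply: leq_trans (leq_mul (leqnn n.+1) IH).
rewrite ![n ^ _.+1]expnS; move: (n ^ m) => x; nia.
Qed.

(** This is [(1 - 1 / P) ^ P <= 1 / 2], from two terms of a binomial expansion. *)
Lemma expn_pred_half P : 0 < P -> 2 * P.-1 ^ P <= P ^ P.
Proof.
case: P => // n _ /=; apply: leq_trans (expn_succ_ge n n).
by rewrite mul2n -addnn leq_add2l expnS leq_mul2r leqnSn orbT.
Qed.

(** In probabilities: [d >= P * z] independent events of probability [1 / P] all fail with
    probability at most [2 ^ -z]. *)
Lemma miss_probability P z d m : 0 < P -> P * z <= d -> d <= m ->
  2 ^ z * (P.-1 ^ d * P ^ (m - d)) <= P ^ m.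
Proof.
move=> P_gt0 zd dm; rewrite -{2}(subnK dm) addnC [P ^ (d + _)]expnD mulnA leq_mul2r.
apply/orP; right; rewrite -(subnK zd) addnC !expnD mulnA; apply: leq_mul.
  rewrite ![_ ^ (P * z)]expnM -expnMn; case: z {zd} => // z; rewrite leq_exp2r //.
  exact: expn_pred_half.
by case: (d - _) => // c; rewrite leq_exp2r // leq_pred.
Qed.

Section Alteration.
Variables (T : finType) (X : {set T}) (M P t z : nat).
Variables (Bad : {set {set T}}) (Ds : seq {set T}).
Hypotheses (XM : #|X| <= M) (P_gt0 : 0 < P).
Hypothesis Bad_ok : forall J, J \in Bad -> J != set0 /\ J \subset X.
Hypothesis few_bad : 2 * \sum_(J in Bad) P ^ (#|T| - #|J|) <= t * P ^ #|T|.
Hypothesis Ds_ok : forall D, D \in Ds -> D \subset X /\ P * z + t <= #|D|.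
Hypothesis few_Ds : 2 * size Ds * M.+1 ^ t < 2 ^ z.

(** Probability by counting: a uniform function keeps each element of [X] independently with
    probability [1 / P]. *)
Let Omega := {ffun T -> 'I_P}.
Let zero := Ordinal P_gt0.
Definition sample (f : Omega) := [set e in X | f e == zero].
Definition bad_in (f : Omega) := [set J in Bad | J \subset sample f].

(** Tuples with blanks encode the subsets of [X] of size at most [t], so that these are easily
    counted. *)
Let code := {ffun 'I_t -> option {x : T | x \in X}}.
Definition decode (tau : code) : {set T} :=
  \bigcup_i (if tau i is Some e then [set val e] else set0).

Lemma card_decode tau : #|decode tau| <= t.
Proof.
apply: leq_trans (card_bigcup_le _ _) _.
rewrite -[leqRHS]card_ord -sum1_card; apply: leq_sum => i _.
by case: (tau i) => [e|]; rewrite ?cards1 ?cards0.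
Qed.

Lemma decode_onto (Z : {set T}) : Z \subset X -> #|Z| <= t -> exists tau, decode tau = Z.
Proof.
move=> ZX Zt; pose tau : code := [ffun i => obind insub (nth None (map Some (enum Z)) (val i))].
exists tau; apply/setP => e; apply/bigcupP/idP => [[i _]|eZ].
  rewrite ffunE; case: (ltnP i (size (enum Z))) => iZ; last first.
    by rewrite nth_default ?size_map //= inE.
  rewrite (nth_map e) //=; case: insubP => [u _ uE|]; last by rewrite inE.
  by rewrite inE uE => /eqP->; rewrite -mem_enum mem_nth.
have iZ : index e (enum Z) < t.
  by apply: leq_trans Zt; rewrite cardE index_mem mem_enum.
exists (Ordinal iZ) => //; rewrite ffunE /= (nth_map e) ?index_mem ?mem_enum //=.
rewrite nth_index ?mem_enum //; case: insubP => [u _ uE|]; last by rewrite (subsetP ZX).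
by rewrite inE uE.
Qed.

Definition many_bad := [set f : Omega | t < #|bad_in f|].
Definition missing D tau := [set f : Omega | [disjoint sample f & D :\: decode tau]].
Definition some_missing := \bigcup_(i < size Ds) \bigcup_(tau : code) missing (nth set0 Ds i) tau.

(** Markov's inequality for the number of bad sets inside the sample. *)
Lemma card_many_bad : 2 * #|many_bad| < P ^ #|T|.
Proof.
have tot : \sum_(f : Omega) #|bad_in f| = \sum_(J in Bad) P ^ (#|T| - #|J|).
  rewrite (eq_bigr (fun f => \sum_(J in bad_in f) 1)) => [|f _]; last by rewrite sum1_card.
  rewrite (exchange_big_dep (mem Bad)) /=; last by move=> f J _; rewrite inE => /andP[].
  apply: eq_bigr => J JB; rewrite sum1_card.
  have [_ JX] := Bad_ok JB.
  have := card_ffun_constrained (A := T) (B := 'I_P) (S := J) (B0 := fun _ => [set zero]) (m := 1).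
  rewrite exp1n mul1n card_ord => <- => [|x _]; last by rewrite cards1.
  apply: eq_card => f; transitivity (J \in bad_in f); first by [].
  rewrite [LHS]in_set JB [RHS]in_set /=.
  apply/subsetP/forall_inP => h x xJ; last first.
    by rewrite inE (subsetP JX) //; have := h x xJ; rewrite inE.
  by have := h x xJ; rewrite !inE => /andP[].
have markov : #|many_bad| * t.+1 <= \sum_(f : Omega) #|bad_in f|.
  rewrite [leqRHS](bigID (mem many_bad)) /=; apply: leq_trans (leq_addr _ _).
  by rewrite -sum_nat_const; apply: leq_sum => f; rewrite inE.
have Pm : 0 < P ^ #|T| by rewrite expn_gt0 P_gt0.
rewrite -(ltn_pmul2r (ltn0Sn t)) -mulnA.
apply: leq_ltn_trans (leq_mul (leqnn 2) markov) _.
rewrite tot; apply: leq_ltn_trans few_bad _.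
by rewrite mulnC ltn_pmul2l.
Qed.

Lemma card_missing D tau : D \in Ds -> 2 ^ z * #|missing D tau| <= P ^ #|T|.
Proof.
move=> /Ds_ok[DX Dbig].
have DZX : D :\: decode tau \subset X := subset_trans (subsetDl _ _) DX.
have -> : missing D tau =
    [set f : Omega | [forall (x | x \in D :\: decode tau), f x \in [set~ zero]]].
  apply/setP => f; rewrite !inE; apply/pred0P/forall_inP => [h x xD|h x] /=.
    by have := h x; rewrite /= xD andbT inE (subsetP DZX) //= !inE => ->.
  apply/negP => /andP[]; rewrite inE => /andP[_ /eqP fx] xD.
  by have := h x xD; rewrite !inE fx eqxx.
rewrite (card_ffun_constrained (m := P.-1)) => [|x _]; last first.
  by rewrite cardsC1 card_ord.
rewrite card_ord; apply: miss_probability => //; last exact: max_card.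
rewrite -(leq_add2r t); apply: leq_trans Dbig _.
have := card_decode tau; rewrite -(leq_add2l #|D :\: decode tau|); apply: leq_trans.
rewrite -(cardsID (decode tau) D) addnC leq_add2l.
exact: subset_leq_card (subsetIr _ _).
Qed.

(** The union bound also runs over all possible deleted sets, because the actual deletion depends on
    the sample. *)
Lemma card_some_missing : 2 * #|some_missing| < P ^ #|T|.
Proof.
have Pm : 0 < P ^ #|T| by rewrite expn_gt0 P_gt0.
have bound : 2 ^ z * #|some_missing| <= size Ds * M.+1 ^ t * P ^ #|T|.
  apply: leq_trans (_ : 2 ^ z *
    (\sum_(i < size Ds) \sum_(tau : code) #|missing (nth set0 Ds i) tau|) <= _).
    rewrite leq_mul2l; apply/orP; right; apply: leq_trans (card_bigcup_le _ _) _.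
    by apply: leq_sum => i _; apply: card_bigcup_le.
  rewrite big_distrr -mulnA -[X in _ <= X * _]card_ord -sum_nat_const; apply: leq_sum => i _ /=.
  rewrite big_distrr /=; apply: leq_trans (_ : \sum_(tau : code) P ^ #|T| <= _).
    by apply: leq_sum => tau _; apply: card_missing; apply: mem_nth.
  rewrite sum_nat_const card_ffun card_option card_sig card_ord leq_mul2r; apply/orP; right.
  case: t => // t'; rewrite leq_exp2r // ltnS; apply: leq_trans XM.
rewrite -(ltn_pmul2l (expn_gt0 2 z : 0 < 2 ^ z)) mulnCA.
apply: leq_ltn_trans (leq_mul (leqnn 2) bound) _.
by rewrite !mulnA ltn_pmul2r.
Qed.

Lemma alteration : exists G : {set T}, [/\ G \subset X,
  forall J, J \in Bad -> ~~ (J \subset G) & forall D, D \in Ds -> exists2 e, e \in G & e \in D].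
Proof.
have [f] : exists f : Omega, f \notin many_bad :|: some_missing.
  apply/existsP; rewrite -negb_forall; apply/negP => /forallP all_in.
  have : P ^ #|T| <= #|many_bad| + #|some_missing|.
    apply: leq_trans (leq_card_setU _ _); rewrite -[P in P ^ _]card_ord -card_ffun.
    by rewrite -cardsT; apply: subset_leq_card; apply/subsetP => f _; apply: all_in.
  by have := card_many_bad; have := card_some_missing; clear; lia.
rewrite inE negb_or inE -leqNgt => /andP[few nmiss].
(* One element is deleted from each bad set in the sample; the default [set0] never occurs, bad sets
   being nonempty. *)
pose Z := \bigcup_(J in bad_in f) (if [pick e in J] is Some e then [set e] else set0).
have ZX : Z \subset X.
  apply/bigcupsP => J; rewrite inE => /andP[/Bad_ok[_ JX] _]; case: pickP => [e eJ|_].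
    by rewrite sub1set (subsetP JX).
  exact: sub0set.
have Zt : #|Z| <= t.
  apply: leq_trans few; apply: leq_trans (card_bigcup_le _ _) _.
  rewrite -sum1_card; apply: leq_sum => J _.
  by case: pickP => [e _|_]; rewrite ?cards1 ?cards0.
exists (sample f :\: Z); split.
- by apply: subset_trans (subsetDl _ _) _; apply/subsetP => e; rewrite inE => /andP[].
- move=> J JB; apply/negP; rewrite subsetD => /andP[JG dJ].
  have [/set0Pn[e0 e0J] _] := Bad_ok JB.
  have JZ : [exists e in J, e \in Z].
    case E: [pick e in J] => [e|]; last by move: E; case: pickP => // /(_ e0); rewrite e0J.
    apply/exists_inP; exists e; first by move: E; case: pickP => // x xJ [<-].
    by apply/bigcupP; exists J; rewrite ?inE ?JB ?JG // E inE.
  by case/exists_inP: JZ => e eJ; rewrite (disjointFr dJ).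
move=> D DDs; have [tau tauZ] := decode_onto ZX Zt.
have : ~~ [disjoint sample f & D :\: Z].
  apply: contra nmiss => dis; apply/bigcupP.
  have iD : index D Ds < size Ds by rewrite index_mem.
  exists (Ordinal iD) => //; apply/bigcupP; exists tau => //.
  by rewrite inE /= nth_index // tauZ.
rewrite -setI_eq0 => /set0Pn[e]; rewrite !inE => /andP[/andP[eX fe] /andP[eZ eD]].
by exists e; rewrite // !inE eZ eX.
Qed.

End Alteration.

(** * Sparse Ramsey graphs *)

Lemma exists_large_exponent A B : exists y,
  [/\ 2 <= y, B <= 2 ^ y & A * y + A < 2 ^ (y - 2)].
Proof.
have [m mE] : exists m, m = 3 * A + B by exists (3 * A + B).
have H := ltn_expl m (isT : 1 < 2); exists (m + m + 2); rewrite addnK !expnD.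
by move: (2 ^ m) H => x h; split; nia.
Qed.

(* For [N = Y ^ (tau * a)], [P = Y ^ (tau * b - 1)] and [u = Y ^ (2 * tau * a - tau * b)]
   this compares the exponents of [Y] in [N ^ j * Y <= u * P ^ l]. *)
Lemma bad_exponent n a b tau j l : tau = 2 ^ n + 2 -> 0 < b -> b < a -> 0 < l -> l <= 2 ^ n ->
  a * j < b * l.-1 + 2 * a ->
  tau * a * j + 1 <= 2 * tau * a - tau * b + (tau * b - 1) * l.
Proof.
move=> ->; move: (2 ^ n) => m b_gt0 ba; case: l => // l _ lm /= h.
have [t tE] : exists t, t = m + 2 by exists (m + 2).
rewrite -tE -!mulnA.
have h1 : t * (a * j) + t <= t * (b * l) + 2 * (t * a).
  by rewrite -mulnSr [2 * _]mulnCA -mulnDr leq_mul2l h orbT.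
have h2 : t * b <= t * a by rewrite leq_mul2l ltnW ?orbT.
have h3 : 0 < t * b by rewrite muln_gt0 b_gt0 tE addn2.
have h4 : (t * b - 1) * l.+1 + l.+1 = t * b + t * (b * l).
  by rewrite mulnBl mul1n subnK ?leq_pmull // mulnS mulnA.
move: h1 h2 h3 h4; move: ((t * b - 1) * l.+1) => p.
move: (t * (a * j)) (t * (b * l)) (t * a) (t * b) => x1 x2 x3 x4; lia.
Qed.

Section BadSets.
Variables (V : finType) (E : {set {set V}}) (n a b : nat).

Definition bad_sets := [set J : {set {set V}} |
  [&& J \subset E, J != set0, #|cover J| <= n & ~~ sparse a b J]].

(** Such a [J] lives on the image of a map from ['I_j], which carries at most [2 ^ (2 ^ n)]
    families. *)
Lemma card_bad_sets j : j <= n ->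
  #|[set J in bad_sets | #|cover J| == j]| <= #|V| ^ j * 2 ^ (2 ^ n).
Proof.
move=> jn.
apply: leq_trans (_ : #|\bigcup_(g : {ffun 'I_j -> V}) powerset (powerset (g @: 'I_j))| <= _).
  apply/subset_leq_card/subsetP => J; rewrite inE => /andP[_ /eqP cJ].
  apply/bigcupP; exists [ffun i => enum_val (cast_ord (esym cJ) i)] => //.
  rewrite powersetE; apply/subsetP => e eJ; rewrite powersetE; apply/subsetP => x xe.
  have xJ : x \in cover J by apply/bigcupP; exists e.
  apply/imsetP; exists (cast_ord cJ (enum_rank_in xJ x)) => //.
  by rewrite ffunE cast_ordK enum_rankK_in.
apply: leq_trans (card_bigcup_le _ _) _.
rewrite -[j in _ ^ j]card_ord -card_ffun -sum_nat_const; apply: leq_sum => g _.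
rewrite !card_powerset; do 2 rewrite leq_exp2l //.
by apply: leq_trans jn; rewrite -[leqRHS]card_ord leq_imset_card.
Qed.

Lemma card_cover_powerset (J : {set {set V}}) : #|J| <= 2 ^ #|cover J|.
Proof.
rewrite -card_powerset; apply/subset_leq_card/subsetP => e eJ.
by rewrite powersetE; apply: bigcup_sup.
Qed.

(** The sum is split by the number of spanned vertices; the spare factor [Y] absorbs the
    constants. *)
Lemma few_bad_sets P N c Y u m : 0 < N -> #|V| = c * N -> 0 < c ->
  2 * (n.+1 * c ^ n * 2 ^ (2 ^ n)) <= Y -> (forall J : {set {set V}}, #|J| <= m) ->
  (forall J, J \in bad_sets -> N ^ #|cover J| * Y <= u * P ^ #|J|) ->
  2 * \sum_(J in bad_sets) P ^ (m - #|J|) <= u * P ^ m.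
Proof.
move=> N_gt0 cV c_gt0 Ybig mbig H; set Z := u * P ^ m.
have each j : j <= n -> Y * \sum_(J in bad_sets | #|cover J| == j) P ^ (m - #|J|) <=
    c ^ n * 2 ^ (2 ^ n) * Z.
  move=> jn; have pN : 0 < N ^ j by rewrite expn_gt0 N_gt0.
  rewrite -(leq_pmul2l pN) mulnA big_distrr /=.
  apply: leq_trans (_ : \sum_(J in bad_sets | #|cover J| == j) Z <= _).
    apply: leq_sum => J /andP[JB /eqP cJ]; have := H J JB; rewrite cJ => h.
    apply: leq_trans (leq_mul h (leqnn _)) _.
    by rewrite -mulnA -expnD subnKC.
  rewrite sum_nat_const mulnA leq_mul2r; apply/orP; right.
  apply: leq_trans (_ : #|V| ^ j * 2 ^ (2 ^ n) <= _).
    apply: leq_trans (card_bad_sets jn); apply: eq_leq; apply: eq_card => J.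
    by rewrite [RHS]in_set.
  rewrite cV mulnA leq_mul2r expnMn mulnC leq_mul2l leq_pexp2l // !orbT //.
have total : Y * \sum_(J in bad_sets) P ^ (m - #|J|) <= n.+1 * c ^ n * 2 ^ (2 ^ n) * Z.
  rewrite (partition_big (fun J : {set {set V}} => inord #|cover J| : 'I_n.+1) xpredT) //=.
  rewrite big_distrr /= -!mulnA -[X in _ <= X * _]card_ord -sum_nat_const.
  apply: leq_sum => i _; have := each i (leq_ord i); rewrite mulnA.
  apply: leq_trans; apply: eq_leq; congr (_ * _); apply: eq_bigl => J.
  rewrite !inE; case: (boolP (#|cover J| <= n)) => cJ; rewrite ?andbF //.
  by congr (_ && _); rewrite -[RHS]/(_ == val i) -[in RHS](inordK (cJ : #|cover J| < n.+1)).
have c0 : 0 < n.+1 * c ^ n * 2 ^ (2 ^ n) by rewrite !muln_gt0 !expn_gt0 c_gt0.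
rewrite -(leq_pmul2l c0); apply: leq_trans total; rewrite mulnCA mulnA leq_mul2r.
by rewrite Ybig orbT.
Qed.

End BadSets.

(** Colour classes without a copy would each lie in a container, but [alteration] makes [G] meet the
    complement of any union of [r] containers while avoiding the small non-sparse sets. *)
Lemma sparse_Ramsey (F : sgraph) r n a b : 0 < b -> b < a ->
  hereditarily_sparse a b (edges F) -> 0 < r -> 0 < #|edges F| ->
  exists (R : sgraph) (N : nat) (G : {set {set blowup R N}}),
    [/\ G \subset edges (blowup R N),
        forall J : {set {set blowup R N}}, J \subset G -> J != set0 ->
          #|cover J| <= n -> sparse a b J &
        forall c : {set blowup R N} -> 'I_r, exists2 phi : canonical_copy R N F,
          phi \in copies R N F & exists k, {in copy_edges phi, forall e, e \in G /\ c e = k}].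
Proof.
move=> b_gt0 ba sp r_gt0 eF.
have [R ramsey] := induced_Ramsey F r_gt0; exists R.
have ne_gt0 : 0 < num_emb R F.
  have [f [inj mono] _] := ramsey (fun _ => Ordinal r_gt0).
  apply/card_gt0P; exists [ffun x => f x]; rewrite inE; apply/is_embP.
  by split=> x y; rewrite !ffunE //; apply: inj.
have R_gt0 : 0 < #|R|.
  have [f _ _] := ramsey (fun _ => Ordinal r_gt0).
  case/card_gt0P: eF => _ /edgesP[x _]; by apply/card_gt0P; exists (f x).
have [k kE] : exists k, #|edges F| = k.+1 by exists #|edges F|.-1; rewrite prednK.
pose K := 2 ^ #|edges F| * (2 * #|edges F|).+1 ^ #|F| * #|R| ^ 2.
have K_gt0 : 0 < K by rewrite !muln_gt0 !expn_gt0 R_gt0.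
have eta_gt0 : 0 < 2 * r * num_emb R F by rewrite !muln_gt0 r_gt0 ne_gt0.
have [D D_gt0 cont] := containers k K_gt0 eta_gt0.
pose tau := 2 ^ n + 2; pose c0 := n.+1 * #|R| ^ n * 2 ^ (2 ^ n).
pose A1 := #|R| ^ 2 * (k * D) * r + 1.
have [y [y2 Ybig ylarge]] := exists_large_exponent
  ((#|R| ^ 2 + 2 * tau * a) * A1 + 1) (D + 2 * c0).
(* [N ^ (- b / a) = Y ^ (- tau * b)] is the scale of the fingerprints. The sampling
   probability [1 / P] exceeds it by the factor [Y], which beats [log N] and all
   constants; [tau] is so large that non-sparse sets are still rare. *)
pose Y := 2 ^ y; pose q := Y ^ tau; pose N := q ^ a.
pose P := Y ^ (tau * b - 1); pose u := Y ^ (2 * tau * a - tau * b).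
pose M := (#|R| * N) ^ 2; pose s := #|R| ^ 2 * u; pose z := u * 2 ^ (y - 2).
have Y_gt0 : 0 < Y by rewrite expn_gt0.
have q_gt0 : 0 < q by rewrite expn_gt0 Y_gt0.
have N_gt0 : 0 < N by rewrite expn_gt0 q_gt0.
have P_gt0 : 0 < P by rewrite expn_gt0 Y_gt0.
have u_gt0 : 0 < u by rewrite expn_gt0 Y_gt0.
have tb : tau * b <= tau * a by rewrite leq_mul2l ltnW ?orbT.
have tb2 : tau * b <= 2 * tau * a by rewrite -mulnA; apply: leq_trans tb (leq_pmull _ _).
have tb_gt0 : 0 < tau * b by rewrite muln_gt0 b_gt0 /tau addn2.
have N2E : N ^ 2 = Y ^ (2 * tau * a).
  by rewrite /N /q -!(expnM Y) mulnC mulnA.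
have qbE : q ^ b = Y ^ (tau * b) by rewrite /q -(expnM Y).
have sQ : s * q ^ b = M.
  rewrite /s /M expnMn -mulnA; congr (_ * _); rewrite N2E qbE /u -(expnD Y).
  by rewrite subnK.
have uY : u * Y * P = N ^ 2.
  rewrite N2E /u /P -{2}[Y]expn1 -!(expnD Y); congr (_ ^ _).
  by move: tb2 tb_gt0; move: (tau * b) (2 * tau * a); clear; lia.
have YE : 2 ^ (y - 2) * 4 = Y by rewrite /Y -{2}(subnK y2) expnD.
have Pz : 4 * (P * z) = N ^ 2.
  by rewrite -uY /z -YE; generalize (2 ^ (y - 2)) u P; clear; lia.
have rare j l : 0 < l -> l <= 2 ^ n -> a * j < b * l.-1 + 2 * a -> N ^ j * Y <= u * P ^ l.
  move=> l_gt0 ln h.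
  rewrite /N /q /u /P -!(expnM Y) -(expnD Y) -{2}[Y]expn1 -(expnD Y) leq_pexp2l //.
  exact: (bad_exponent (n := n)).
exists N.
set X := edges (blowup R N); set w := @copy_weight R N F.
have XM : #|X| <= M by exact: card_edges_blowup.
have s_gt0 : 0 < s by rewrite muln_gt0 expn_gt0 R_gt0.
have sD : s * D <= M.
  rewrite -sQ leq_mul2l; apply/orP; right; apply: leq_trans (_ : Y <= _).
    exact: leq_trans (leq_addr _ _) Ybig.
  by rewrite qbE -{1}[Y]expn1 leq_pexp2l.
have unif : uniform k.+1 w by rewrite -kE; exact: copy_weight_uniform.
have supp : supported X w by exact: copy_weight_supported.
have W_gt0 : 0 < wtot w by rewrite wtot_copy_weight muln_gt0 ne_gt0 expn_gt0 N_gt0.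
have sprd : spread M s K w.
  move=> U U0; have := copy_degree q_gt0 sp (erefl N) U0.
  have MU : M ^ #|U| = M * M ^ #|U|.-1 by rewrite -expnS prednK // card_gt0.
  rewrite -wtot_copy_weight -/w MU => h.
  apply: leq_trans (_ : #|R| ^ 2 * s ^ #|U|.-1 *
    (wdeg w U * (q ^ b) ^ #|U|.-1 * N ^ 2) <= _); last first.
    apply: leq_trans (leq_mul (leqnn _) h) _; apply: eq_leq; rewrite /K.
    generalize (s ^ #|U|.-1) (2 ^ #|edges F|) ((2 * #|edges F|).+1 ^ #|F|).
    by generalize (#|R| ^ 2) (wtot w); clear; lia.
  apply: eq_leq; rewrite -{2}sQ expnMn /M expnMn.
  generalize (s ^ #|U|.-1) ((q ^ b) ^ #|U|.-1) (#|R| ^ 2) (N ^ 2) (wdeg w U); clear; lia.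
have [L sL [L1 L2]] := cont _ X M s w XM s_gt0 sD unif supp W_gt0 sprd.
pose miss (h : {ffun 'I_r -> 'I_(size L)}) := X :\: \bigcup_i nth set0 L (h i).
pose Ds := [seq miss h | h : {ffun 'I_r -> 'I_(size L)}].
have Dsbig h : N ^ 2 <= 2 * #|miss h|.
  apply: (supersaturation (F := F) N_gt0 r_gt0 ne_gt0 ramsey) => i.
  by have [] := L1 (nth set0 L (h i)) (mem_nth _ (ltn_ord _)).
have [||||G [GX Gbad GD]] := @alteration _ X M P u z (bad_sets X n a b) Ds XM P_gt0.
- by move=> J; rewrite inE => /and4P[].
- apply: (few_bad_sets (N := N) (c := #|R|) (Y := Y)) => //.
  + by rewrite card_prod card_ord.
  + exact: leq_trans (leq_addl _ _) Ybig.
  + by move=> J; apply: max_card.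
  move=> J; rewrite inE => /and4P[JX J0 cJ nsp].
  apply: rare; first by rewrite card_gt0.
    by apply: leq_trans (card_cover_powerset J) _; rewrite leq_exp2l.
  by move: nsp; rewrite /sparse -ltnNge.
- move=> _ /mapP[h _ ->]; split; first exact: subsetDl.
  (* [P * z] and the deletion budget [u] are each at most a quarter of [N ^ 2], and [miss h] has at
     least half of [N ^ 2] elements. *)
  have u4 : 4 * u <= N ^ 2.
    rewrite -uY -YE; apply: leq_trans (leq_pmulr _ P_gt0).
    by rewrite mulnC leq_mul2l leq_pmull ?expn_gt0 ?orbT.
  have := Dsbig h; move: Pz u4; generalize (P * z) (N ^ 2) #|miss h| u; clear; lia.
- have M1 : M.+1 <= 2 ^ (#|R| ^ 2 + 2 * tau * a * y).
    rewrite /M expnMn N2E /Y -expnM expnD [y * _]mulnC.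
    have : #|R| ^ 2 < 2 ^ (#|R| ^ 2) by apply: ltn_expl.
    have : 0 < 2 ^ (2 * tau * a * y) by rewrite expn_gt0.
    generalize (2 ^ (2 * tau * a * y)) (2 ^ (#|R| ^ 2)) (#|R| ^ 2); clear; nia.
  (* The choices of [r] containers account for the first summand of [A1], the deletions for its
     [+ 1]. *)
  have sDs : size Ds * M.+1 ^ u <= M.+1 ^ (u * A1).
    rewrite /Ds size_image card_ffun !card_ord.
    rewrite /A1 mulnDr muln1 expnD leq_mul2r; apply/orP; right.
    apply: leq_trans (_ : (M.+1 ^ (s * (k * D))) ^ r <= _).
      by case: (r) r_gt0 => // r' _; rewrite leq_exp2r.
    rewrite -expnM leq_pexp2l // /s; apply: eq_leq.
    generalize (#|R| ^ 2) u; clear; lia.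
  rewrite -mulnA; apply: leq_ltn_trans (leq_mul (leqnn 2) sDs) _.
  apply: leq_ltn_trans (_ : 2 ^ (1 + (#|R| ^ 2 + 2 * tau * a * y) * (u * A1)) < _).
    rewrite expnD expn1 leq_mul2l /= (expnM 2).
    have : 0 < u * A1 by rewrite muln_gt0 u_gt0 /A1 addn1.
    by case: (u * A1) => // e _; rewrite leq_exp2r.
  rewrite ltn_exp2l // /z; move: ylarge u_gt0 y2.
  generalize (2 ^ (y - 2)) (#|R| ^ 2) (2 * tau * a) A1 u; clear => x c t A u h u0 y2.
  apply: leq_trans (_ : u * (1 + (c + t * y) * A).+1 <= _); first by nia.
  rewrite leq_mul2l; apply/orP; right; apply: leq_trans h; nia.
exists G; split=> //.
  move=> J JG J0 cJ; apply/negPn/negP => nsp; have := Gbad J; rewrite JG inE.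
  by rewrite (subset_trans JG GX) J0 cJ nsp => /(_ isT).
move=> c; pose I i := [set e in G | c e == i].
case: (boolP [exists phi : canonical_copy R N F, (phi \in copies R N F) &&
    [exists i, copy_edges phi \subset I i]]) => [|none].
  case/existsP => phi /andP[phiC /existsP[i sub]]; exists phi => //; exists i => e /(subsetP sub).
  by rewrite inE => /andP[? /eqP].
have cov i : exists j : 'I_(size L), I i \subset nth set0 L j.
  have [||C CL IC] := L2 (I i).
  - by apply: subset_trans GX; apply/subsetP => e; rewrite inE => /andP[].
  - move=> S /copy_weight_gt0[phi phiC <-]; apply/negP => sub.
    case/negP: none; apply/existsP; exists phi; rewrite phiC; apply/existsP; by exists i.
  have iC : index C L < size L by rewrite index_mem.
  by exists (Ordinal iC); rewrite /= nth_index.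
have [h Hh] := @fin_all_exists 'I_r (fun _ => 'I_(size L)) _ cov.
have [|e eG] := GD (miss [ffun i => h i]).
  by apply/mapP; exists [ffun i => h i]; rewrite // mem_enum.
rewrite inE => /andP[/bigcupP[]]; exists (c e) => //.
by rewrite ffunE; apply: (subsetP (Hh _)); rewrite inE eG eqxx.
Qed.

(** * The theorem *)

Section ImageTight.
Variables (U V : finType) (f : U -> V) (a b : nat).
Hypothesis inj : injective f.

Definition edge_image (X : {set {set U}}) := [set f @: e | e : {set U} in X].

Lemma card_edge_image X : #|edge_image X| = #|X|.
Proof. by rewrite card_imset //; apply: imset_inj. Qed.

Lemma cover_edge_image X : cover (edge_image X) = f @: cover X.
Proof.
apply/setP => y; apply/bigcupP/imsetP.
  case=> _ /imsetP[e eX ->] /imsetP[x xe ->].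
  by exists x => //; apply/bigcupP; exists e.
by case=> x /bigcupP[e eX xe] ->; exists (f @: e); apply: imset_f.
Qed.

Lemma tight_edge_image X : tight a b (edge_image X) = tight a b X.
Proof. by rewrite /tight card_edge_image cover_edge_image card_imset. Qed.

Lemma tight_atom_image K : tight_atom a b K -> tight_atom a b (edge_image K).
Proof.
case=> tK K2 minK; split; rewrite ?tight_edge_image ?card_edge_image // => X XK X0 tX.
pose X' := [set e in K | f @: e \in X].
have XE : X = edge_image X'.
  apply/setP => d; apply/idP/imsetP => [dX|[e]]; last by rewrite inE => /andP[_ ?] ->.
  have /imsetP[e eK dE] := subsetP XK _ dX.
  by exists e => //; rewrite inE eK -dE.
have [|||E|c1] := minK X'.
- by apply/subsetP => e; rewrite inE => /andP[].
- by apply: contraNneq X0 => X'0; rewrite XE X'0 /edge_image imset0.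
- by rewrite -tight_edge_image -XE.
- by left; rewrite XE E.
by right; rewrite XE card_edge_image.
Qed.

End ImageTight.

Section EdgeGraph.
Variables (B : sgraph) (G : {set {set B}}).
Hypothesis GB : G \subset edges B.

Definition edge_adj (x y : B) := [set x; y] \in G.
Lemma edge_adj_sym : symmetric edge_adj.
Proof. by move=> x y; rewrite /edge_adj setUC. Qed.
Lemma edge_adj_irr : irreflexive edge_adj.
Proof. by move=> x; apply/negP => /(subsetP GB); rewrite in_edges adj_irr. Qed.
Definition edge_graph := SGraph edge_adj_sym edge_adj_irr.

Lemma edges_edge_graph : edges edge_graph = G.
Proof.
apply/setP => e; apply/edgesP/idP => [[x [y [xy ->]]] //|eG].
by have /edgesP[x [y [_ E]]] := subsetP GB _ eG; exists x, y; rewrite /= /edge_adj -E.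
Qed.

End EdgeGraph.

Definition total_colouring (G : sgraph) r (r_gt0 : 0 < r) (c : edge_colouring G r)
  (e : {set G}) : 'I_r := oapp c (Ordinal r_gt0) (insub e).

Lemma total_colouringE (G : sgraph) r (r_gt0 : 0 < r) (c : edge_colouring G r) e :
  total_colouring r_gt0 c (val e) = c e.
Proof. by rewrite /total_colouring valK. Qed.

(** Inducedness: a blow-up edge between vertices of the copy projects to an edge of [R], which comes
    from [F] because [phi.1] is an embedding. *)
Lemma copy_induced (R F : sgraph) N r (G : {set {set blowup R N}})
    (GX : G \subset edges (blowup R N)) (r_gt0 : 0 < r)
    (c : edge_colouring (edge_graph GX) r) (phi : canonical_copy R N F) k :
  phi \in copies R N F ->
  {in copy_edges phi, forall e, e \in G /\ total_colouring r_gt0 c e = k} ->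
  exists S : subgraph (edge_graph GX), [/\ induced S, isomorphic F S & monochromatic c S].
Proof.
move=> phiC mono; have inj := copy_inj phiC.
have [_ emb] : embedding (phi.1 : F -> R) by apply/is_embP; move: phiC; rewrite inE.
have sE : copy_edges phi \subset edges (edge_graph GX).
  by rewrite edges_edge_graph; apply/subsetP => e /mono[].
pose vs : {set edge_graph GX} := [set copy_fun phi x | x in F].
have sV e : e \in copy_edges phi -> e \subset vs.
  by case/imsetP => d _ ->; apply/subsetP => _ /imsetP[x _ ->]; apply: imset_f.
have adjE x y : ([set copy_fun phi x; copy_fun phi y] \in copy_edges phi) = adj x y.
  rewrite -in_edges -imset_pair; apply/imsetP/idP => [[e eF /(imset_inj inj)->] //|xy].
  by exists [set x; y].
exists (@Subgraph (edge_graph GX) vs (copy_edges phi) sE sV); split.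
- move=> e; rewrite edges_edge_graph => eG /= eV.
  have /edgesP[p [q [pq E]]] := subsetP GX _ eG.
  have /imsetP[x _ px] : p \in vs by rewrite (subsetP eV) // E set21.
  have /imsetP[y _ qy] : q \in vs by rewrite (subsetP eV) // E set22.
  rewrite E px qy adjE -emb; move: pq; rewrite px qy; exact.
- have xV x : copy_fun phi x \in vs by apply: imset_f.
  exists (fun x => exist _ (copy_fun phi x) (xV x)); split.
    apply: inj_card_bij => [x y /(congr1 val)/inj //|].
    rewrite card_sig; apply: leq_trans (leq_imset_card (copy_fun phi) F).
    by apply: eq_leq; apply: eq_card.
  by move=> x y; rewrite /= /sub_adj /= adjE.
by exists k => e /= /mono[_]; rewrite total_colouringE.
Qed.

(** [two_colouring] puts both colours on every injective image of [K] in [H], while a monochromatic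
    [F] would contain a monochromatic image. *)
Lemma sparse_not_arrows (F G : sgraph) (H : subgraph G) a b (K : {set {set F}}) :
  K \subset edges F -> tight_atom a b K -> hereditarily_sparse a b (sub_eset H) ->
  ~ nni_arrows H F 2.
Proof.
move=> KF atomK sp arrows.
pose Q (S : {set {set G}}) := [exists f : {ffun F -> G}, injectiveb f && (S == edge_image f K)].
have [|col proper] := @two_colouring G a b Q _ (sub_eset H) sp.
  by move=> S /existsP[f /andP[/injectiveP finj /eqP->]]; apply: tight_atom_image.
pose c : edge_colouring H 2 := fun e => if col [set val x | x in val e] then ord_max else ord0.
have [S [[g [gbij gmono]] [k mono]]] := arrows c.
pose f := [ffun x => val (val (g x))].
have finj : injective f by move=> x y; rewrite !ffunE => /val_inj/val_inj/(bij_inj gbij).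
have edge x y : adj x y -> [set val (g x); val (g y)] \in sub_eset S.
  by rewrite -gmono.
have edgeH x y : adj x y -> [set val (g x); val (g y)] \in edges H.
  by move/edge/(subsetP (sub_edges S)).
have colE x y : adj x y -> (if col [set f x; f y] then ord_max else ord0) = k.
  move=> xy; rewrite -(mono (exist (fun e => e \in edges H) _ (edgeH _ _ xy)) (edge _ _ xy)) /c /=.
  by rewrite imset_pair !ffunE.
have QK : Q (edge_image f K).
  by apply/existsP; exists f; rewrite eqxx andbT; apply/injectiveP.
have sub : edge_image f K \subset sub_eset H.
  apply/subsetP => _ /imsetP[e /(subsetP KF)/edgesP[x [y [xy ->]]] ->].
  have := edgeH _ _ xy; rewrite in_edges /= /sub_adj imset_pair !ffunE; exact.
(* The value [k == ord0] asks for an edge of the colour other than [k]. *)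
have [_ /imsetP[e /(subsetP KF)/edgesP[x [y [xy ->]]] ->]] := proper _ QK sub (k == ord0).
rewrite imset_pair => col_xy; have := colE x y xy; rewrite col_xy.
by case: eqP => [-> | nk e0]; [case/eqP | case: nk].
Qed.

Theorem theorem1p7 (F : sgraph) (r n : nat) :
  contains_cycle F -> 2 <= r ->
  exists G : sgraph,
    induced_arrows G F r /\
    forall H : subgraph G, #|sub_vset H| = n -> ~ nni_arrows H F 2.
Proof.
move=> cycF r2; have r_gt0 : 0 < r := ltnW r2.
have [a [b [K [b_gt0 ba KF spF atomK]]]] := densest_core cycF.
have eF : 0 < #|edges F|.
  have [_ K2 _] := atomK.
  by apply: leq_trans (subset_leq_card KF); apply: leq_trans K2.
have [R [N [G [GX sparseG ramsey]]]] := sparse_Ramsey n b_gt0 ba spF r_gt0 eF.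
exists (edge_graph GX); split.
  move=> c; have [phi phiC [k mono]] := ramsey (total_colouring r_gt0 c).
  exact: copy_induced phiC mono.
(* Every edge set of [H] spans at most [n] vertices, so local sparsity of [G] makes [H] hereditarily
   sparse. *)
move=> H cH; apply: (sparse_not_arrows KF atomK) => X XH X0.
have HG : sub_eset H \subset G by have := sub_edges H; rewrite edges_edge_graph.
apply: sparseG => //; first exact: subset_trans XH HG.
rewrite -cH; apply/subset_leq_card/bigcupsP => e eX.
exact: (@sub_ends _ H e (subsetP XH _ eX)).
Qed.
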